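(* Let $0<n<d$ be integers and $1\le p<\infty$. Suppose $E\subset\mathbb{R}^d$ is $n$-Ahlfors-David regular. Then $E$ has big pieces of Lipschitz graphs (BPLG) if and only if the measure $\mathcal{H}^n|_E$ has big pieces of bounded energy for $p$ (BPBE($p$)).
   Context: $\mathcal{H}^n$ is $n$-dimensional Hausdorff measure, $G(d,m)$ the Grassmannian of $m$-dimensional linear subspaces of $\mathbb{R}^d$, $B(x,r)$ the open ball, $r(B)$ the radius of a ball $B$. $E\subset\mathbb{R}^d$ is $n$-Ahlfors-David regular ($n$-ADR) if there are constants $C_0,C_1>0$ such that $C_0r^n\le\mathcal{H}^n(E\cap B(x,r))\le C_1r^n$ for all $x\in E$ and $0<r<\operatorname{diam}(E)$. A Lipschitz graph (of dimension $n$) is a set $\Gamma=\{v+F(v):v\in W\}$ with $W\in G(d,n)$ and $F:W\to W^\perp$ Lipschitz; $\operatorname{Lip}(\Gamma)$ denotes the Lipschitz constant of $F$. An $n$-ADR set $E$ has BPLG if there exist constants $\kappa,L>0$ such that for every ball $B$ centered at $E$ with $0<r(B)<\operatorname{diam}(E)$ there is a Lipschitz graph $\Gamma_B$ with $\operatorname{Lip}(\Gamma_B)\le L$ and $\mathcal{H}^n(E\cap B\cap\Gamma_B)\ge\kappa\,r(B)^n$. For $V\in G(d,d-n)$ and $\alpha>0$, $K(x,V,\alpha,r)=\{y\in B(x,r):\operatorname{dist}(y,V+x)<\alpha|x-y|\}$. A measure $\mu$ has BPBE($p$) if there exist constants $\alpha,\kappa,M_0>0$ such that for every ball $B$ centered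 at $\operatorname{supp}\mu$ with $0<r(B)<\operatorname{diam}(\operatorname{supp}\mu)$ there exist a set $G_B\subset B$ with $\mu(G_B)\ge\kappa\,\mu(B)$ and a direction $V_B\in G(d,d-n)$ such that for all $x\in G_B$ $$\int_0^{r(B)}\Big(\frac{\mu(K(x,V_B,\alpha,r))}{r^n}\Big)^p\frac{dr}{r}\le M_0 .$$ *)

(* Defs.v *)
From HB Require Import structures.
From mathcomp Require Import all_boot all_order all_algebra.
From mathcomp Require Import all_classical all_reals all_analysis.

Set Implicit Arguments.
Unset Strict Implicit.
Unset Printing Implicit Defensive.

Import Order.TTheory GRing.Theory Num.Theory.
Import numFieldNormedType.Exports.

Local Open Scope classical_set_scope.
Local Open Scope ring_scope.

(* The library norm on ['rV[R]_d] is the sup norm, hence the notions below. *)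
Section Euclidean.
Context {R : realType} {d : nat}.
Implicit Types (x y u v : 'rV[R]_d) (A : set 'rV[R]_d).

Definition edot u v : R := \sum_(i < d) u 0 i * v 0 i.

Definition enorm u : R := Num.sqrt (edot u u).

Definition eball x (r : R) : set 'rV[R]_d := [set y | enorm (x - y) < r].

(* [diam set0 = 0], whereas the supremum of the empty set in [\bar R] is -oo *)
Definition diam A : \bar R :=
  maxe 0%E (ereal_sup [set (enorm (x - y))%:E | x in A & y in A]).

Definition edist y A : R := inf [set enorm (y - z) | z in A].

Definition Gr (m : nat) : set {vspace 'rV[R]_d} := [set W | \dim W = m].

Definition orthocompl (W : {vspace 'rV[R]_d}) : set 'rV[R]_d :=
  [set u | forall w, w \in W -> edot u w = 0].

Definition translate (V : {vspace 'rV[R]_d}) x : set 'rV[R]_d :=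
  [set v + x | v in [set` V]].

End Euclidean.

Section Hausdorff.
Context {R : realType} {d : nat}.
Implicit Types (A : set 'rV[R]_d) (n : nat).
Local Open Scope ereal_scope.

(* Sending [set0] to 0 only matters for n = 0, where [0 ^+ 0 = 1]. *)
Definition diam_pow n A : \bar R :=
  if A == set0 then 0 else diam A ^+ n.

Definition delta_cover (delta : R) A : set (set 'rV[R]_d)^nat :=
  [set U | A `<=` \bigcup_k U k /\ forall k, diam (U k) <= delta%:E].

Definition hausdorff_pre n (delta : R) A : \bar R :=
  ereal_inf [set \sum_(k <oo) diam_pow n (U k) | U in delta_cover delta A].

(* No normalizing constant: [hausdorff n] is H^n up to a positive factor
   depending only on n. *)
Definition hausdorff n A : \bar R :=
  ereal_sup [set hausdorff_pre n delta A | delta in [set delta | (0 < delta)%R]].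

Lemma diam_ge0 A : 0 <= diam A.
Proof. by rewrite /diam le_max lexx. Qed.

Lemma diam_set0 : diam (set0 : set 'rV[R]_d) = 0.
Proof.
rewrite /diam (_ : [set _ | _ in _ & _ in _] = set0) ?ereal_sup0 ?maxeNy//.
by apply/seteqP; split => // x [].
Qed.

Lemma diam_pow_ge0 n A : 0 <= diam_pow n A.
Proof. by rewrite /diam_pow; case: ifP => // _; exact/expe_ge0/diam_ge0. Qed.

Lemma diam_pow_set0 n : diam_pow n (set0 : set 'rV[R]_d) = 0.
Proof. by rewrite /diam_pow eqxx. Qed.

Lemma le_hausdorff_pre n delta : {homo hausdorff_pre n delta : A B / A `<=` B >-> A <= B}.
Proof.
move=> A B AB; apply/ereal_inf_le_tmp => _ [U [BU dU] <-].
by exists U => //; split => //; exact: subset_trans AB BU.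
Qed.

Lemma hausdorff_pre_ge0 n delta A : 0 <= hausdorff_pre n delta A.
Proof.
apply: le_ereal_inf_tmp => _ [U _ <-].
by apply: nneseries_ge0 => k _ _; exact: diam_pow_ge0.
Qed.

Lemma hausdorff_pre0 n delta : (0 < delta)%R -> hausdorff_pre n delta set0 = 0.
Proof.
move=> d0; apply/eqP; rewrite eq_le hausdorff_pre_ge0 andbT.
apply: ereal_inf_lbound; exists (fun=> set0).
  by split => // k; rewrite diam_set0 lee_fin ltW.
by apply: eseries0 => k _ _; exact: diam_pow_set0.
Qed.

Lemma hausdorff_pre_sigma_subadditive n delta :
  sigma_subadditive (hausdorff_pre n delta).
Proof.
set mu := hausdorff_pre n delta.
have mu_ge0 X : 0 <= mu X by exact: hausdorff_pre_ge0.
move=> A; have [[i ioo]|] := pselect (exists i, mu (A i) = +oo).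
  rewrite (eseries_pinfty _ _ ioo) ?leey// => k _.
  by rewrite -ltNye (lt_le_trans _ (mu_ge0 _)).
rewrite -forallNE => Aoo.
suff add2e (e : {posnum R}) :
    mu (\bigcup_n A n) <= \sum_(i <oo) mu (A i) + e%:num%:E.
  by apply/lee_addgt0Pr => _/posnumP[].
rewrite (le_trans _ (epsilon_trick _ _ _))//.
pose P k (B : (set 'rV[R]_d)^nat) := delta_cover delta (A k) B /\
  \sum_(j <oo) diam_pow n (B j) <= mu (A k) + (e%:num / (2 ^ k.+1)%:R)%:E.
have [G PG] : {G : ((set 'rV[R]_d)^nat)^nat & forall k, P k (G k)}.
  apply: (@choice _ _ P) => k; rewrite /P /mu /hausdorff_pre.
  set S := (X in ereal_inf X); move infS : (ereal_inf S) => iS.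
  case: iS infS => [r Sr|Soo|Soo].
  - have en1 : (0 < e%:num / (2 ^ k.+1)%:R)%R by [].
    have /(lb_ereal_inf_adherent en1) : ereal_inf S \is a fin_num by rewrite Sr.
    move=> [x [B AB muBx] xS].
    by exists B; split => //; rewrite muBx -Sr; exact/ltW.
  - by have := Aoo k; rewrite /mu /hausdorff_pre Soo.
  - by have := mu_ge0 (A k); rewrite /mu /hausdorff_pre -/S Soo.
have muG_ge0 x : 0 <= (diam_pow n \o uncurry G) x by exact: diam_pow_ge0.
apply: (@le_trans _ _ (\esum_(i in setT) (diam_pow n \o uncurry G) i)).
  apply: ereal_inf_lbound => /=.
  have /card_esym/ppcard_eqP[f] := card_nat2.
  exists (uncurry G \o f).
    split => [|i]; last first.
      by rewrite /=; case: (f i) => a b /=; have [[_ +] _] := PG a; exact.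
    move=> t [i _]; have [[sub _] _] := PG i.
    move=> /sub[j _ Gijt]; exists (f^-1%FUN (i, j)) => //=.
    by rewrite invK ?inE.
  rewrite -(esum_pred_image (diam_pow n \o uncurry G) _ xpredT) ?[fun=> _]set_true//.
  by rewrite image_eq.
rewrite (_ : esum _ _ = \sum_(i <oo) \sum_(j <oo) diam_pow n (G i j)); last first.
  pose J : nat -> set (nat * nat) := fun i => [set (i, j) | j in setT].
  rewrite (_ : setT = \bigcup_k J k); last first.
    by rewrite predeqE => -[a b]; split => // _; exists a => //; exists b.
  rewrite esum_bigcupT /=; last 2 first.
    - apply/trivIsetP => i j _ _ ij.
      rewrite predeqE => -[k m] /=; split => //= -[] [_] _ [<-{k} _].
      by move=> [m' _] [] /esym/eqP; rewrite (negbTE ij).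
    - by move=> /= [k m]; exact: diam_pow_ge0.
  rewrite -(image_id [set: nat]) -fun_true esum_pred_image//; last first.
    by move=> k _; apply: esum_ge0 => ? _; exact: diam_pow_ge0.
  apply: eq_eseriesr => /= j _.
  rewrite -(esum_pred_image (diam_pow n \o uncurry G) (pair j) predT)/=; last 2 first.
    by move=> ? _; exact: diam_pow_ge0.
    by move=> ? ? _ _; exact: (@can_inj _ _ _ snd).
  by congr esum; rewrite predeqE => -[a b]; split; move=> [i _ <-]; exists i.
apply: lee_nneseries => k _; last exact: (PG k).2.
by move=> _; apply: nneseries_ge0 => *; exact: diam_pow_ge0.
Qed.

Lemma hausdorff_ge0 n A : 0 <= hausdorff n A.
Proof.
apply: (le_trans (hausdorff_pre_ge0 n 1 A)).
by apply: ereal_sup_ubound; exists 1%R => //=.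
Qed.

Lemma hausdorff0 n : hausdorff n set0 = 0.
Proof.
apply/eqP; rewrite eq_le hausdorff_ge0 andbT.
by apply: ge_ereal_sup => _ [delta /= d0 <-]; rewrite hausdorff_pre0.
Qed.

Lemma le_hausdorff n : {homo hausdorff n : A B / A `<=` B >-> A <= B}.
Proof.
move=> A B AB; apply: ge_ereal_sup => _ [delta d0 <-].
by apply: (le_trans (le_hausdorff_pre n delta AB)); apply: ereal_sup_ubound; exists delta.
Qed.

Lemma hausdorff_sigma_subadditive n : sigma_subadditive (hausdorff n).
Proof.
move=> F; apply: ge_ereal_sup => _ [delta d0 <-].
apply: (le_trans (@hausdorff_pre_sigma_subadditive n delta F)).
apply: lee_nneseries => k _; first by move=> _; exact: hausdorff_pre_ge0.
by apply: ereal_sup_ubound; exists delta.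
Qed.

HB.instance Definition _ n := isOuterMeasure.Build R 'rV[R]_d (hausdorff n)
  (hausdorff0 n) (hausdorff_ge0 n) (@le_hausdorff n)
  (@hausdorff_sigma_subadditive n).

End Hausdorff.

Section OuterRestriction.
Context {R : realType} {T : Type}.
Variables (mu : {outer_measure set T -> \bar R}) (E : set T).
Local Open Scope ereal_scope.

Definition outer_restr (A : set T) : \bar R := mu (A `&` E).

Lemma outer_restr0 : outer_restr set0 = 0.
Proof. by rewrite /outer_restr set0I outer_measure0. Qed.

Lemma outer_restr_ge0 A : 0 <= outer_restr A.
Proof. exact: outer_measure_ge0. Qed.

Lemma le_outer_restr : {homo outer_restr : A B / A `<=` B >-> A <= B}.
Proof. by move=> A B AB; apply: le_outer_measure; exact: setSI. Qed.

Lemma outer_restr_sigma_subadditive : sigma_subadditive outer_restr.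
Proof.
by move=> F; rewrite /outer_restr setI_bigcupl; exact: outer_measure_sigma_subadditive.
Qed.

HB.instance Definition _ := isOuterMeasure.Build R T outer_restr
  outer_restr0 outer_restr_ge0 le_outer_restr outer_restr_sigma_subadditive.

End OuterRestriction.

Section Regularity.
Context {R : realType} {d : nat}.
Implicit Types (E Gamma : set 'rV[R]_d) (mu : {outer_measure set 'rV[R]_d -> \bar R}).

Definition ADR (n : nat) E : Prop :=
  exists C0 C1 : R, 0 < C0 /\ 0 < C1 /\
    forall (x : 'rV[R]_d) (r : R), E x -> 0 < r -> (r%:E < diam E)%E ->
      ((C0 * r ^+ n)%:E <= hausdorff n (E `&` eball x r) <= (C1 * r ^+ n)%:E)%E.

(* [Gamma] is an n-dimensional Lipschitz graph with Lip(Gamma) <= L; only the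
   values of [F] on [W] matter. *)
Definition lipschitz_graph (n : nat) (L : R) Gamma : Prop :=
  exists (W : {vspace 'rV[R]_d}) (F : 'rV[R]_d -> 'rV[R]_d),
    [/\ Gr n W,
        forall v, v \in W -> orthocompl W (F v),
        forall v w, v \in W -> w \in W ->
          enorm (F v - F w) <= L * enorm (v - w)
      & Gamma = [set v + F v | v in [set` W]]].

Definition BPLG (n : nat) E : Prop :=
  exists kappa L : R, 0 < kappa /\ 0 < L /\
    forall (x : 'rV[R]_d) (r : R), E x -> 0 < r -> (r%:E < diam E)%E ->
      exists Gamma, lipschitz_graph n L Gamma /\
        ((kappa * r ^+ n)%:E <= hausdorff n (E `&` eball x r `&` Gamma))%E.

Definition cone x (V : {vspace 'rV[R]_d}) (alpha r : R) : set 'rV[R]_d :=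
  [set y | eball x r y /\ edist y (translate V x) < alpha * enorm (x - y)].

Definition supp mu : set 'rV[R]_d :=
  [set x | forall r : R, 0 < r -> (0 < mu (eball x r))%E].

Definition conical_energy (n : nat) (p : R) mu x V (alpha r : R) : \bar R :=
  (\int[lebesgue_measure]_(t in `]0%R, r[)
     ((mu (cone x V alpha t) * (t ^- n)%:E) `^ p * (t^-1)%:E))%E.

Definition BPBE (n : nat) (p : R) mu : Prop :=
  exists alpha kappa M0 : R, 0 < alpha /\ 0 < kappa /\ 0 < M0 /\
    forall (x : 'rV[R]_d) (r : R), supp mu x -> 0 < r -> (r%:E < diam (supp mu))%E ->
      exists (G : set 'rV[R]_d) (V : {vspace 'rV[R]_d}),
        [/\ G `<=` eball x r,
            (kappa%:E * mu (eball x r) <= mu G)%E,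
            Gr (d - n) V
          & forall z, G z -> (conical_energy n p mu z V alpha r <= M0%:E)%E].

End Regularity.

(* Main.v *)
From HB Require Import structures.
Require Import Defs.
From mathcomp Require Import all_boot all_order all_algebra.
From mathcomp Require Import all_classical all_reals all_analysis.
From mathcomp Require Import measurable_realfun zify ring lra.
Import Order.TTheory GRing.Theory Num.Theory.
Import numFieldNormedType.Exports.

Local Open Scope classical_set_scope.
Local Open Scope ring_scope.

Set Implicit Arguments.
Unset Strict Implicit.
Unset Printing Implicit Defensive.

(** Both properties amount to the existence, in every ball, of a big piece of [E]
    on which the number of bad scales of a point is bounded: scales [k] at which
    the cone with apex [x] contains a point of [E] at distance about [2 ^ - k].
    On such a piece the energies for all exponents [p] are bounded together.

    Bounded energy gives few bad scales. If a point [y] lies in a narrow cone about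
    [V] with apex [x], then a ball about [y] with radius comparable to [|x - y|]
    lies in a wider cone, and regularity bounds the energy from below on a dyadic
    interval of radii ([count_cone_scale_le]). Few bad scales give a graph. Colour
    the points, at each scale [k], by the residues of the coordinates of their grid
    cube, so that points of one colour are never at distance about [2 ^ - k]
    ([grid_colouring]). If one of the [N] colours is prescribed at random for every
    scale and [x] is kept when it has the prescribed colour at all of its bad
    scales, then [x] survives with probability at least [N ^ - M], where [M] bounds
    the number of bad scales. Hence some prescription keeps a fixed proportion of
    the measure ([exists_colour_choice], where the expectation is replaced by a
    greedy choice). Two kept points cannot be in each other's cone: that would be a
    bad scale for both, at which they have the same colour. So the kept set is a
    Lipschitz graph over the orthogonal complement of [V]
    ([cone_free_subset_graph]).

    Conversely let [Gamma] be a Lipschitz graph over [W], let [V] be the orthogonal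
    complement of [W], and take a narrow cone about [V] with apex [x] on [Gamma]. A
    point [y] of this cone is at distance comparable to [|x - y|] from [Gamma]
    ([graph_cone_dist]). So a scale is bad for [x] only if [x] is near the points of
    [E] at distance about [2 ^ - k] from [Gamma]. By a packing argument the set of
    these [x] has measure at most a constant times that of a layer around [Gamma] of
    thickness about [2 ^ - k], and the layers overlap boundedly
    ([sum_off_graph_scale_le]). Chebyshev's inequality then gives a big piece of
    the graph with few bad scales ([bounded_count_big_piece]), and each bad scale
    contributes a bounded amount to the energy ([energy_integral_le]).

    Measures of arbitrary subsets of [E] occur throughout, so everything is phrased
    with outer measures, which are only split along open sets and their complements.
    These are Caratheodory measurable because Hausdorff measure is a metric outer
    measure ([eopen_caratheodory]). *)

(** * The Euclidean norm and orthogonal complements *)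

Section EuclideanNorm.
Context {R : realType} {d : nat}.
Implicit Types (x y z u v w : 'rV[R]_d).

Lemma edotC u v : edot u v = edot v u.
Proof. by apply: eq_bigr => i _; rewrite mulrC. Qed.

Lemma edotDl u v w : edot (u + v) w = edot u w + edot v w.
Proof. by rewrite -big_split; apply: eq_bigr => i _; rewrite mxE mulrDl. Qed.

Lemma edotZl a u v : edot (a *: u) v = a * edot u v.
Proof. by rewrite mulr_sumr; apply: eq_bigr => i _; rewrite mxE mulrA. Qed.

Lemma edotDr u v w : edot w (u + v) = edot w u + edot w v.
Proof. by rewrite ![edot w _]edotC edotDl. Qed.

Lemma edotZr a u v : edot v (a *: u) = a * edot v u.
Proof. by rewrite ![edot v _]edotC edotZl. Qed.

Lemma edotvv_ge0 u : 0 <= edot u u.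
Proof. by apply: sumr_ge0 => i _; rewrite -expr2 sqr_ge0. Qed.

Lemma enorm_ge0 u : 0 <= enorm u.
Proof. exact: sqrtr_ge0. Qed.

Lemma sqr_enorm u : enorm u ^+ 2 = edot u u.
Proof. by rewrite sqr_sqrtr // edotvv_ge0. Qed.

Lemma edotvv_eq0 u : edot u u = 0 -> u = 0.
Proof.
move=> /eqP; rewrite psumr_eq0 => [/allP u0|i _]; last by rewrite -expr2 sqr_ge0.
apply/rowP => i; have := u0 i (mem_index_enum i).
by rewrite mxE /= mulf_eq0 orbb => /eqP.
Qed.

Lemma enorm0 : enorm (0 : 'rV[R]_d) = 0.
Proof. by rewrite /enorm /edot big1 ?sqrtr0 // => i _; rewrite mxE mul0r. Qed.

Lemma enormZ a u : enorm (a *: u) = `|a| * enorm u.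
Proof.
by rewrite /enorm edotZl edotZr mulrA -expr2 sqrtrM ?sqr_ge0 // sqrtr_sqr.
Qed.

Lemma enormN u : enorm (- u) = enorm u.
Proof. by rewrite -scaleN1r enormZ normrN1 mul1r. Qed.

Lemma enormB x y : enorm (x - y) = enorm (y - x).
Proof. by rewrite -enormN opprB. Qed.

(** Expanding the square of [|v| u - |u| v] gives [|u||v| >= u.v]. *)
Lemma le_edot_enorm u v : edot u v <= enorm u * enorm v.
Proof.
have [u0|u0] := eqVneq (enorm u) 0.
  have /edotvv_eq0 -> : edot u u = 0 by rewrite -sqr_enorm u0 expr0n.
  rewrite enorm0 mul0r /edot big1 // => i _; by rewrite mxE mul0r.
have [v0|v0] := eqVneq (enorm v) 0.
  have /edotvv_eq0 -> : edot v v = 0 by rewrite -sqr_enorm v0 expr0n.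
  rewrite enorm0 mulr0 /edot big1 // => i _; by rewrite mxE mulr0.
have ab0 : 0 < enorm u * enorm v.
  by rewrite mulr_gt0 // lt_neqAle eq_sym enorm_ge0 ?u0 ?v0.
have := edotvv_ge0 (enorm v *: u + (- enorm u) *: v).
rewrite edotDl !edotDr !edotZl !edotZr -!sqr_enorm (edotC v u) => h.
rewrite -(ler_pM2l ab0); nra.
Qed.

Lemma enormD u v : enorm (u + v) <= enorm u + enorm v.
Proof.
rewrite -(@ler_pXn2r _ 2) ?nnegrE ?addr_ge0 ?enorm_ge0 //.
rewrite sqr_enorm edotDl !edotDr -!sqr_enorm (edotC v u).
have := le_edot_enorm u v; nra.
Qed.

Lemma enorm_triangle y x z : enorm (x - z) <= enorm (x - y) + enorm (y - z).
Proof. by have := enormD (x - y) (y - z); rewrite addrA subrK. Qed.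

Lemma enorm_coord u i : `|u 0 i| <= enorm u.
Proof.
rewrite -sqrtr_sqr ler_sqrt ?edotvv_ge0 // /edot (bigD1 i) //= -expr2 lerDl.
by apply: sumr_ge0 => j _; rewrite -expr2 sqr_ge0.
Qed.

Lemma enorm_le_sum u : enorm u <= \sum_(i < d) `|u 0 i|.
Proof.
rewrite -(@ler_pXn2r _ 2) ?nnegrE ?sumr_ge0 ?enorm_ge0 // sqr_enorm expr2.
rewrite mulr_suml; apply: ler_sum => i _.
rewrite -expr2 -real_normK ?num_real // expr2 ler_wpM2l //.
by rewrite (bigD1 i) //= lerDl sumr_ge0.
Qed.

Lemma enorm_le_coord u (c : R) : (forall i, `|u 0 i| <= c) -> enorm u <= d%:R * c.
Proof.
move=> uc; apply: le_trans (enorm_le_sum u) _.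
by rewrite -[in leRHS](card_ord d) mulr_natl -sumr_const ler_sum.
Qed.

Lemma orthogonal_enorm_le u v : edot u v = 0 -> enorm u <= enorm (u + v).
Proof.
move=> uv; rewrite ler_sqrt ?edotvv_ge0 // edotDl !edotDr (edotC v u) uv.
by rewrite addr0 add0r lerDl edotvv_ge0.
Qed.

(** The orthogonal complement of [V] is the kernel of [u |-> (u.b_i)_i], [b] a
    basis of [V]; it is a complement because it meets [V] only in 0. *)
Lemma orthocompl_vspace (V : {vspace 'rV[R]_d}) : exists W : {vspace 'rV[R]_d},
  [/\ \dim W = (d - \dim V)%N,
      forall w, (w \in W) <-> orthocompl V w
    & forall u, exists2 w, w \in W & u - w \in V].
Proof.
pose b := vbasis V.
pose f (u : 'rV[R]_d) : 'rV[R]_(\dim V) := \row_i edot u b`_i.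
have lf : linear f.
  by move=> a u v; apply/rowP => i; rewrite !mxE edotDl edotZl.
pose fl : {linear 'rV[R]_d -> 'rV[R]_(\dim V)} :=
  HB.pack f (GRing.isLinear.Build _ _ _ _ f lf).
pose phi := linfun fl.
pose W := lker phi.
have phiE u : phi u = f u by rewrite lfunE.
have WP w : (w \in W) <-> orthocompl V w.
  rewrite memv_ker phiE; split=> [/eqP /rowP fw v vV|ow].
    rewrite (coord_vbasis vV); elim/big_rec: _ => [|i y _ IH].
      by rewrite /edot big1 // => j _; rewrite mxE mulr0.
    by rewrite edotDr IH addr0 edotZr; have := fw i; rewrite !mxE => ->; rewrite mulr0.
  apply/eqP/rowP => i; rewrite !mxE ow //.
  by rewrite vbasis_mem // memt_nth // size_tuple.
have VW0 : (W :&: V = 0)%VS.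
  apply/eqP; rewrite -subv0; apply/subvP => w; rewrite memv_cap memv0.
  by move=> /andP[/WP wW wV]; apply/eqP/edotvv_eq0/wW.
have dimT : \dim {:'rV[R]_d} = d by rewrite dimvf /dim /= mul1n.
have dW : (d - \dim V <= \dim W)%N.
  have := limg_ker_dim phi fullv; rewrite capfv dimT -/W => h.
  have : (\dim (limg phi) <= \dim V)%N.
    apply: leq_trans (dimvS (subvf _)) _.
    by rewrite dimvf /dim /= mul1n.
  lia.
have dWV : (\dim W + \dim V = \dim (W + V))%N by rewrite dimv_disjoint_sum.
have dWVd : (\dim (W + V) <= d)%N by have := dimvS (subvf (W + V)%VS); rewrite dimT.
have dV : (\dim V <= d)%N by have := dimvS (subvf V); rewrite dimT.
have eW : \dim W = (d - \dim V)%N.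
  lia.
exists W; split => // u.
have full : (W + V)%VS = fullv.
  apply/eqP; rewrite eqEdim subvf /= -dWV dimT; lia.
have : u \in (W + V)%VS by rewrite full memvf.
by move=> /memv_addP[w wW [v vV ->]]; exists w => //; rewrite addrAC subrr add0r.
Qed.

End EuclideanNorm.

(** * Counting and thinning for outer measures *)

Lemma setIDCA {T : Type} (A B D : set T) : (A `&` B) `\` D = (A `\` D) `&` B.
Proof. by rewrite !setDE setIAC. Qed.

Section EnatmulTheory.
Context {R : realType}.
Implicit Types (x y : \bar R) (m n : nat).
Local Open Scope ereal_scope.

Lemma enatmulDl x y n : (x + y) *+ n = x *+ n + y *+ n.
Proof.
elim: n => [|n IH]; first by rewrite !mule0n adde0.
by rewrite !muleS IH addeACA.
Qed.

Lemma enatmul0 n : 0 *+ n = 0 :> \bar R.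
Proof. by rewrite -mule_natl mule0. Qed.

Lemma enatmulDr x m n : x *+ (m + n) = x *+ m + x *+ n.
Proof. by elim: m => [|m IH]; rewrite ?add0e // addSn !muleS IH addeA. Qed.

Lemma enatmulM x m n : x *+ (m * n) = x *+ m *+ n.
Proof. by elim: n => [|n IH]; rewrite ?muln0 // mulnS enatmulDr IH muleS. Qed.

Lemma enatmul_ge0 x n : 0 <= x -> 0 <= x *+ n.
Proof. by move=> x0; rewrite -mule_natl mule_ge0. Qed.

Lemma le_enatmul x y m n : 0 <= x -> x <= y -> (m <= n)%N -> x *+ m <= y *+ n.
Proof.
move=> x0 xy mn; rewrite -!mule_natl.
by rewrite lee_pmul ?lee_fin ?ler_nat.
Qed.

End EnatmulTheory.

Section Counting.
Context {R : realType} {T : Type}.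
Variable mu : {outer_measure set T -> \bar R}.
Implicit Types (X : set T) (O : (set T)^nat).
Local Open Scope ereal_scope.

Definition count_below O J (x : T) : nat := \sum_(k < J) (x \in O k).

Lemma count_belowS O J x :
  count_below O J.+1 x = (count_below O J x + (x \in O J))%N.
Proof. by rewrite /count_below big_ord_recr. Qed.

Lemma count_below_homo O J J' x : (J <= J')%N ->
  (count_below O J x <= count_below O J' x)%N.
Proof.
move=> /subnKC <-; elim: (J' - J)%N => [|m IH]; first by rewrite addn0.
by rewrite addnS count_belowS (leq_trans IH) ?leq_addr.
Qed.

Lemma count_below_eq0 O J x :
  (forall k, (k < J)%N -> ~ O k x) -> count_below O J x = 0%N.
Proof. by move=> nO; rewrite /count_below big1 // => k _; rewrite memNset //; exact: nO. Qed.

Lemma count_below_le_add O J m x : (count_below O (J + m) x <= count_below O J x + m)%N.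
Proof.
elim: m => [|m IH]; first by rewrite !addn0.
by rewrite addnS count_belowS addnS -addn1 leq_add // leq_b1.
Qed.

Lemma count_below_shift O m J x :
  (count_below O (m + J) x <= m + count_below (fun k => O (m + k)%N) J x)%N.
Proof.
elim: J => [|J IH]; last by rewrite addnS !count_belowS addnA leq_add2r.
rewrite addn0 -{1}[m]add0n; apply: leq_trans (count_below_le_add _ _ _ _) _.
by rewrite {1}/count_below big_ord0 add0n leq_addr.
Qed.

Lemma count_below_size O J x :
  count_below O J x = size [seq k <- iota 0 J | x \in O k].
Proof.
rewrite size_filter -sum1_count big_mkcond /= /count_below.
rewrite -(big_mkord xpredT (fun k => (x \in O k) : nat)) /index_iota subn0.
by apply: eq_bigr => i _; case: ifP.
Qed.

(** All indices [k] with [x \in O k] lie in a window of length [m]. *)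
Lemma count_below_spread O m J x :
  (forall i j, (i + m <= j)%N -> O i x -> ~ O j x) -> (count_below O J x <= m)%N.
Proof.
move=> sp; elim: J => [|J IH]; first by rewrite /count_below big_ord0.
have [OJ|nOJ] := pselect (O J x); last by rewrite count_belowS memNset // addn0.
have [Jm|mJ] := leqP J.+1 m.
  apply: leq_trans Jm; rewrite -[X in (_ <= X)%N]add0n -{1}[J.+1]add0n.
  by apply: leq_trans (count_below_le_add _ _ _ _) _; rewrite {1}/count_below big_ord0.
rewrite -(subnK (ltnW mJ)); apply: leq_trans (count_below_le_add _ _ _ _) _.
rewrite count_below_eq0 // => k kJ Ok; apply: (sp k J) => //; lia.
Qed.

Lemma bounded_count_seq O m x : (forall J, (count_below O J x <= m)%N) ->
  exists2 s : seq nat, (size s <= m)%N & forall k, O k x -> k \in s.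
Proof.
move=> cm; have [c [J <-] cmax] : exists2 c, (exists J, count_below O J x = c) &
    forall J, (count_below O J x <= c)%N.
  have ex : exists c, `[< exists J, count_below O J x = c >].
    by exists (count_below O 0 x); apply/asboolP; exists 0%N.
  have bd c : `[< exists J, count_below O J x = c >] -> (c <= m)%N.
    by move=> /asboolP[J <-].
  case: (ex_maxnP ex bd) => c /asboolP cP cmax; exists c => // J.
  by apply: cmax; apply/asboolP; exists J.
exists [seq k <- iota 0 J | x \in O k] => [|k Ok]; first by rewrite -count_below_size.
rewrite mem_filter mem_set //= mem_iota add0n ltnNge; apply/negP => Jk.
have := cmax k.+1; rewrite count_belowS mem_set // addn1 ltnNge.
by rewrite count_below_homo.
Qed.

Lemma caratheodoryE O k X : mu.-caratheodory (O k) ->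
  mu X = mu (X `&` O k) + mu (X `\` O k).
Proof. by rewrite setDE; exact. Qed.

(** Integrating the pointwise bound on the number of the [O k] that contain a
    point, without integrals: split [X] along [O J]. *)
Lemma sum_outer_measure_le O m J X : (forall k, mu.-caratheodory (O k)) ->
  (forall x, X x -> (count_below O J x <= m)%N) ->
  \sum_(k < J) mu (X `&` O k) <= mu X *+ m.
Proof.
move=> mO; elim: J m X => [|J IH] m X Xm.
  by rewrite big_ord0 -mule_natl mule_ge0 // outer_measure_ge0.
rewrite big_ord_recr /=.
under eq_bigr => k _.
  rewrite (@caratheodoryE O J (X `&` O k)) // setIAC setIDCA; over.
rewrite big_split /= (@caratheodoryE O J X) // enatmulDl addeAC.
apply: leeD; last first.
  apply: IH => x [Xx nO]; have := Xm _ Xx.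
  by rewrite count_belowS memNset // addn0.
case: m Xm => [|m] Xm.
  have -> : X `&` O J = set0.
    apply/seteqP; split => // x [Xx Ox]; have := Xm _ Xx.
    by rewrite count_belowS mem_set // addn1.
  rewrite mule0n outer_measure0 adde0 big1 // => k _.
  by rewrite set0I outer_measure0.
rewrite muleS [leRHS]addeC leeD2r //; apply: IH => x [Xx Ox]; have := Xm _ Xx.
by rewrite count_belowS mem_set // addn1.
Qed.

(** Chebyshev's inequality for the number of the [O k] that contain a point. *)
Lemma outer_measure_mul_le_sum O m J X : (forall k, mu.-caratheodory (O k)) ->
  (forall x, X x -> (m <= count_below O J x)%N) ->
  mu X *+ m <= \sum_(k < J) mu (X `&` O k).
Proof.
move=> mO; elim: J m X => [|J IH] m X Xm.
  have [->|/set0P[x Xx]] := eqVneq X set0.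
    by rewrite outer_measure0 enatmul0 big_ord0.
  by have := Xm _ Xx; rewrite /count_below !big_ord0 leqn0 => /eqP ->.
rewrite big_ord_recr /=.
under eq_bigr => k _.
  rewrite (@caratheodoryE O J (X `&` O k)) // setIAC setIDCA; over.
rewrite big_split /= [in leLHS](@caratheodoryE O J X) // enatmulDl addeAC.
apply: leeD; last first.
  apply: IH => x [Xx nO]; have := Xm _ Xx.
  by rewrite count_belowS memNset // addn0.
case: m Xm => [|m] Xm.
  by rewrite mule0n adde_ge0 ?sume_ge0 // => *; exact: outer_measure_ge0.
rewrite muleS [leLHS]addeC leeD2r //; apply: IH => x [Xx Ox]; have := Xm _ Xx.
by rewrite count_belowS mem_set // addn1.
Qed.

Lemma outer_measure_small_tail (F : (set T)^nat) (C eps : R) : (0 < eps)%R ->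
  (forall J, \sum_(k < J) mu (F k) <= C%:E) ->
  exists J, mu (\bigcup_(k in ~` `I_J) F k) <= eps%:E.
Proof.
move=> eps0 FC.
have F0 k : 0 <= mu (F k) by exact: outer_measure_ge0.
have foo : \sum_(0 <= k <oo) mu (F k) < +oo.
  apply: (@le_lt_trans _ _ C%:E); last by rewrite ltry.
  apply: lime_le; first by apply: is_cvg_nneseries => *.
  by apply: nearW => J; rewrite big_mkord.
have /fine_cvgP[_] := nneseries_tail_cvg foo (fun k _ => F0 k).
move=> /cvgrPdist_lt/(_ _ eps0)[J _ /(_ J (leqnn _))] /=.
rewrite sub0r normrN => h; exists J.
apply: le_trans (outer_measure_sigma_subadditive_tail _ _ _) _.
have tge0 : 0 <= \sum_(J <= k <oo) mu (F k) by apply: nneseries_ge0.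
have tfin : \sum_(J <= k <oo) mu (F k) \is a fin_num.
  rewrite ge0_fin_numE //; apply: le_lt_trans foo.
  rewrite (@nneseries_split _ _ 0%N J) // add0n leeDr // sume_ge0 //.
rewrite -(fineK tfin) lee_fin (le_trans (ler_norm _)) // ltW //.
Qed.

(** Chebyshev for the finite counts, and a small tail for the rest. *)
Lemma bounded_count_big_piece O X (K a : R) : (0 < a)%R ->
  (forall k, mu.-caratheodory (O k)) ->
  (forall J, \sum_(k < J) mu (X `&` O k) <= K%:E) ->
  forall m, (4 * K <= a * m.+1%:R)%R -> mu X <= mu (X `&`
    [set x | forall J, (count_below O J x <= m)%N]) + (a / 2)%:E.
Proof.
move=> a0 mO sumK m Km.
have [J JP] := @outer_measure_small_tail (fun k => X `&` O k) K (a / 4)%R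
  ltac:(by rewrite divr_gt0) sumK.
set G := [set x | _].
pose Y := X `&` [set x | (m < count_below O J x)%N].
have Ya : mu Y <= (a / 4)%:E.
  have : mu Y *+ m.+1 <= K%:E.
    apply: le_trans (outer_measure_mul_le_sum (J := J) mO _) _ => [x []//|].
    apply: le_trans (sumK J); apply: lee_sum => k _.
    by apply: le_outer_measure => x [[]].
  have Yge0 : 0 <= mu Y by exact: outer_measure_ge0.
  move: Yge0; case: (mu Y) => [y| |] //; last by rewrite enatmul_pinfty leye_eq.
  rewrite -EFin_natmul !lee_fin => y0 yK.
  rewrite -(ler_pM2r (_ : 0 < m.+1%:R :> R)%R) ?ltr0n // mulr_natr.
  apply: le_trans yK _; rewrite mulrAC ler_pdivlMr // mulrC //.
have sub : X `<=` (X `&` G) `|` (Y `|` \bigcup_(k in ~` `I_J) (X `&` O k)).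
  move=> x Xx; have [[k [Jk Ok]]|no] := pselect (exists k, (J <= k)%N /\ O k x).
    by right; right; exists k => //=; apply/negP; rewrite -leqNgt.
  have [mY|Ym] := ltnP m (count_below O J x); first by right; left.
  left; split => // J'; have [J'J|JJ'] := leqP J' J.
    exact: leq_trans (count_below_homo _ _ J'J) Ym.
  apply: leq_trans Ym; rewrite -(subnKC (ltnW JJ')).
  elim: (J' - J)%N => [|i IH]; first by rewrite addn0.
  rewrite addnS count_belowS memNset ?addn0 // => Ok.
  by apply: no; exists (J + i)%N; rewrite leq_addr.
apply: le_trans (le_outer_measure mu _ _ sub) _.
apply: le_trans (outer_measureU2 _ _ _) _; rewrite leeD2l //.
apply: le_trans (outer_measureU2 _ _ _) _.
apply: le_trans (leeD Ya JP) _; rewrite -EFinD lee_fin; lra.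
Qed.

End Counting.

Section Thinning.
Context {R : realType} {T : Type} {C : finType}.
Variables (mu : {outer_measure set T -> \bar R}) (O : (set T)^nat).
Variable col : nat -> T -> C.
Hypothesis mO : forall k, mu.-caratheodory (O k).
Implicit Types (X : set T) (s : seq C).
Local Open Scope ereal_scope.

Let N := #|C|.

Let class k (c : C) : set T := [set x | col k x = c].

(** The colours [s] (latest first) are those chosen at the indices [k < size s].
    [weight s] plays the role of the measure that lives on the points kept so far
    and has density [N] to the number of the [O k] that contain the point. Its
    average over the next colour is at least [weight s], so some colour does not
    decrease it: this is the greedy choice. *)
Fixpoint weight s X : \bar R :=
  if s is c :: s' then
    weight s' (X `\` O (size s')) +
    weight s' (X `&` O (size s') `&` class (size s') c) *+ N
  else mu X.

Lemma weight_ge0 s X : 0 <= weight s X.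
Proof.
elim: s X => [|c s IH] X /=; first exact: outer_measure_ge0.
by rewrite adde_ge0 // -mule_natl mule_ge0.
Qed.

Lemma weight_set0 s : weight s set0 = 0.
Proof.
elim: s => [|c s IH] /=; first exact: outer_measure0.
by rewrite set0D !set0I IH enatmul0 adde0.
Qed.

Lemma weightU s X Y : weight s (X `|` Y) <= weight s X + weight s Y.
Proof.
elim: s X Y => [|c s IH] X Y /=; first exact: outer_measureU2.
rewrite addeACA -enatmulDl setDUl !setIUl.
by apply: leeD; rewrite ?le_enatmul ?weight_ge0.
Qed.

Lemma weight_bigU s (I : Type) (r : seq I) (F : I -> set T) :
  weight s (\big[setU/set0]_(i <- r) F i) <= \sum_(i <- r) weight s (F i).
Proof.
elim: r => [|i r IH]; first by rewrite !big_nil weight_set0.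
by rewrite !big_cons (le_trans (weightU _ _ _)) // leeD2l.
Qed.

Lemma weight_caratheodory s k X :
  weight s X = weight s (X `&` O k) + weight s (X `\` O k).
Proof.
elim: s X => [|c s IH] X /=; first exact: caratheodoryE.
rewrite addeACA -enatmulDl setIDCA.
rewrite (_ : X `\` O k `\` O (size s) = X `\` O (size s) `\` O k); last first.
  by rewrite !setDE setIAC.
rewrite -IH; congr (_ + _ *+ N).
rewrite [LHS]IH; congr (weight _ _ + weight _ _).
- by rewrite setIAC; congr (_ `&` _); rewrite setIAC.
- by rewrite !setDE setIAC; congr (_ `&` _); rewrite setIAC.
Qed.

Let best X s : C -> C := fun c0 =>
  [arg max_(c > c0) weight s (X `&` O (size s) `&` class (size s) c)]%O.

Lemma le_weight_best X s c0 : weight s X <= weight (best X s c0 :: s) X.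
Proof.
rewrite (weight_caratheodory s (size s) X) /= addeC leeD2l //.
rewrite /best; case: arg_maxP => //= c _ cmax.
have XE : X `&` O (size s) =
    \big[setU/set0]_(c' : C) (X `&` O (size s) `&` class (size s) c').
  rewrite -bigcup_seq; apply/seteqP; split => [x Xx|x [c' _] []//].
  by exists (col (size s) x) => //=; rewrite mem_index_enum.
rewrite [leLHS](_ : _ = weight s
  (\big[setU/set0]_(c' : C) (X `&` O (size s) `&` class (size s) c'))); last first.
  by rewrite -XE.
apply: le_trans (weight_bigU _ _ _) _.
have le c' : true -> weight s (X `&` O (size s) `&` class (size s) c') <=
    weight s (X `&` O (size s) `&` class (size s) c) by move=> _; exact: cmax.
apply: le_trans (lee_sum _ le) _.
rewrite big_const (_ : #|_| = N) //.
by elim: (N) => // m IH; rewrite iterS muleS leeD2l.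
Qed.

Definition kept (c : nat -> C) J : set T :=
  [set x | forall k, (k < J)%N -> O k x -> col k x = c k].

Fixpoint greedy X c0 J : seq C :=
  if J is J'.+1 then best X (greedy X c0 J') c0 :: greedy X c0 J' else [::].

Lemma size_greedy X c0 J : size (greedy X c0 J) = J.
Proof. by elim: J => //= J ->. Qed.

Lemma le_weight_greedy X c0 J : mu X <= weight (greedy X c0 J) X.
Proof. by elim: J => //= J IH; exact: le_trans IH (le_weight_best _ _ _). Qed.

Let greedy_colour X c0 k := best X (greedy X c0 k) c0.

(** The density is at most [N ^ m] where at most [m] of the [O k] overlap. *)
Lemma weight_greedy_le X c0 J m Y :
  (forall x, Y x -> (count_below O J x <= m)%N) ->
  weight (greedy X c0 J) Y <= mu (Y `&` kept (greedy_colour X c0) J) *+ (N ^ m).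
Proof.
elim: J m Y => [|J IH] m Y Ym.
  rewrite /= (_ : _ `&` _ = Y); last by apply/seteqP; split => // x [].
  apply: (@le_enatmul _ _ _ 1); rewrite ?outer_measure_ge0 //.
  by rewrite expn_gt0 /N; apply/orP; left; apply/card_gt0P; exists c0.
rewrite /= size_greedy -/(greedy_colour X c0 J).
set K := kept _ _.
rewrite (caratheodoryE (Y `&` K) (mO J)) enatmulDl addeC.
apply: leeD; last first.
  apply: le_trans (IH m _ _) _ => [x [Yx nO]|].
    by have := Ym _ Yx; rewrite count_belowS memNset // addn0.
  apply: le_enatmul; rewrite ?outer_measure_ge0 // le_outer_measure //.
  move=> x [[Yx nO] Kx]; split => //; split => // k.
  by rewrite ltnS leq_eqVlt => /predU1P[-> /nO|] //; exact: Kx.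
have subYK : Y `&` O J `&` class J (greedy_colour X c0 J) `&`
    kept (greedy_colour X c0) J `<=` Y `&` K `&` O J.
  move=> x [[[Yx Ox] cx] Kx]; split => //; split => // k.
  by rewrite ltnS leq_eqVlt => /predU1P[-> _|] //; exact: Kx.
case: m Ym => [|m] Ym.
  rewrite (_ : _ `&` class _ _ = set0) ?weight_set0 ?enatmul0 ?enatmul_ge0 //.
    exact: outer_measure_ge0.
  apply/seteqP; split => // x [[Yx Ox] _]; have := Ym _ Yx.
  by rewrite count_belowS mem_set // addn1.
rewrite expnSr enatmulM le_enatmul ?weight_ge0 //.
apply: le_trans (IH m _ _) _ => [x [[Yx Ox] _]|].
  by have := Ym _ Yx; rewrite count_belowS mem_set // addn1.
by apply: le_enatmul; rewrite ?outer_measure_ge0 // le_outer_measure.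
Qed.

(** If no point of [X] lies in more than [m] of the sets [O k], then one colour
    per index can be prescribed so that a fixed proportion of [X] obeys the
    prescription at every index [k] with [x \in O k]: independent uniform
    colours keep each point with probability at least [N ^ - m]. *)
Lemma exists_colour_choice X m : C -> mu X < +oo ->
  (forall J x, X x -> (count_below O J x <= m)%N) ->
  exists c : nat -> C,
    mu X <= mu (X `&` [set x | forall k, O k x -> col k x = c k]) *+ (2 * N ^ m).
Proof.
move=> c0 Xoo Xm; exists (greedy_colour X c0).
set K := [set x | _].
have N0 : (0 < N ^ m)%N.
  by rewrite expn_gt0 /N; apply/orP; left; apply/card_gt0P; exists c0.
have Xfin : mu X \is a fin_num by rewrite ge0_fin_numE // outer_measure_ge0.
have [X0|X0] := eqVneq (mu X) 0.
  by rewrite X0 enatmul_ge0 // outer_measure_ge0.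
have Xgt0 : (0 < fine (mu X))%R.
  by rewrite fine_gt0 // Xoo andbT lt0e X0 outer_measure_ge0.
pose eps : R := (fine (mu X) / 2 / (N ^ m)%:R)%R.
have eps0 : (0 < eps)%R by rewrite !divr_gt0 // ltr0n.
have [J J1] : exists J, mu (\bigcup_(k in ~` `I_J) (X `&` O k)) <= eps%:E.
  apply: (outer_measure_small_tail (C := fine (mu X) *+ m)) => // J.
  apply: le_trans (sum_outer_measure_le mO (Xm J)) _.
  by rewrite EFin_natmul fineK.
have XK : X `&` kept (greedy_colour X c0) J `<=`
    (X `&` K) `|` \bigcup_(k in ~` `I_J) (X `&` O k).
  move=> x [Xx Kx]; have [[k [Jk Ok]]|no] :=
      pselect (exists k, (J <= k)%N /\ O k x).
    by right; exists k => //=; apply/negP; rewrite -leqNgt.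
  left; split => // k Ok; apply: Kx => //; rewrite ltnNge; apply/negP => Jk.
  by apply: no; exists k.
have h : mu X <= (mu (X `&` K) + eps%:E) *+ (N ^ m).
  apply: le_trans (le_weight_greedy _ c0 J) _.
  apply: le_trans (weight_greedy_le X c0 (Xm J)) _.
  apply: le_enatmul => //; first exact: outer_measure_ge0.
  apply: le_trans (le_outer_measure mu _ _ XK) _.
  by apply: le_trans (outer_measureU2 _ _ _) _; rewrite leeD2l.
have half : eps%:E *+ (N ^ m) = (fine (mu X) / 2)%:E.
  rewrite -EFin_natmul; congr (_%:E); rewrite -(mulr_natr eps) divfK //.
  by rewrite pnatr_eq0 -lt0n.
have muXK : mu (X `&` K) \is a fin_num.
  rewrite ge0_fin_numE ?outer_measure_ge0 // (le_lt_trans _ Xoo) //.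
  exact: le_outer_measure.
move: h; rewrite enatmulDl half mulnC enatmulM mule2n.
rewrite -(fineK Xfin) -(fineK muXK) -EFin_natmul -!EFinD !lee_fin; lra.
Qed.

End Thinning.

(** * Hausdorff measure is a metric outer measure *)

Lemma eballE {R : realType} {d : nat} (x y : 'rV[R]_d) r :
  eball x r y = (enorm (x - y) < r) :> Prop.
Proof. by []. Qed.

Section HausdorffMetric.
Context {R : realType} {d : nat}.
Implicit Types (A B X O : set 'rV[R]_d) (x y : 'rV[R]_d) (n : nat).
Local Open Scope ereal_scope.

Lemma le_diam A B : A `<=` B -> diam A <= diam B.
Proof.
move=> AB; rewrite /diam ge_max le_max lexx /= le_max; apply/orP; right.
by apply: ereal_sup_le => _ [x Ax [y Ay <-]]; exists x; [exact: AB|exists y => //; exact: AB].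
Qed.

Lemma le_diam_pow n A B : A `<=` B -> diam_pow n A <= diam_pow n B.
Proof.
rewrite /diam_pow; have [->|B0] := eqVneq B set0.
  by rewrite subset0 => ->; rewrite eqxx.
case: eqP => _ AB; first exact/expe_ge0/diam_ge0.
elim: n => // n IH; rewrite !expeS; apply: lee_pmul => //.
- exact: diam_ge0.
- exact/expe_ge0/diam_ge0.
- exact: le_diam.
Qed.

Lemma le_enorm_diam A x y : A x -> A y -> (enorm (x - y))%:E <= diam A.
Proof.
move=> Ax Ay; rewrite /diam le_max; apply/orP; right; apply: ereal_sup_ubound.
by exists x => //; exists y.
Qed.

Lemma enorm_le_diam A x y (c : R) : diam A <= c%:E -> A x -> A y ->
  (enorm (x - y) <= c)%R.
Proof. by move=> Ac Ax Ay; rewrite -lee_fin; exact: le_trans (le_enorm_diam _ _) Ac. Qed.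

(** A covering set of diameter less than [eps] meets only one of [A] and [B]. *)
Lemma hausdorff_pre_separated n (delta eps : R) A B : (delta < eps)%R ->
  (forall x y, A x -> B y -> (eps <= enorm (x - y))%R) ->
  hausdorff_pre n delta A + hausdorff_pre n delta B <= hausdorff_pre n delta (A `|` B).
Proof.
move=> de sep; apply: le_ereal_inf_tmp => _ [U [ABU dU] <-].
have ge0 V k : 0 <= diam_pow n (V k : set 'rV[R]_d) by exact: diam_pow_ge0.
have sub V : V `<=` A `|` B -> hausdorff_pre n delta V <=
    \sum_(k <oo) diam_pow n (U k `&` V).
  move=> VAB; apply: ereal_inf_lbound; exists (fun k => U k `&` V) => //.
  split=> [x Vx|k]; last exact: le_trans (le_diam (@subIsetl _ _ _)) (dU k).
  by have [k _ Uk] := ABU _ (VAB _ Vx); exists k.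
apply: le_trans (leeD (sub A _) (sub B _)) _ => //.
rewrite -nneseriesD //; apply: lee_nneseries => k _.
  by rewrite adde_ge0.
have [UB|/set0P[y [Uy By]]] := eqVneq (U k `&` B) set0.
  by rewrite UB diam_pow_set0 adde0; apply: le_diam_pow.
rewrite (_ : U k `&` A = set0) ?diam_pow_set0 ?add0e; first exact: le_diam_pow.
apply/seteqP; split => // x [Ux Ax].
by have := sep _ _ Ax By; rewrite leNgt (le_lt_trans (enorm_le_diam (dU k) Ux Uy)).
Qed.

Lemma le_hausdorff_pre_delta n (delta delta' : R) A : (delta' <= delta)%R ->
  hausdorff_pre n delta A <= hausdorff_pre n delta' A.
Proof.
move=> dd; apply: ereal_inf_le_tmp => _ [U [AU dU] <-]; exists U => //.
by split => // k; rewrite (le_trans (dU k)) // lee_fin.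
Qed.

Lemma hausdorff_separated n (eps : R) A B : (0 < eps)%R ->
  (forall x y, A x -> B y -> (eps <= enorm (x - y))%R) ->
  hausdorff n A + hausdorff n B <= hausdorff n (A `|` B).
Proof.
move=> eps0 sep.
have main a b : (0 < a)%R -> (0 < b)%R ->
    hausdorff_pre n a A + hausdorff_pre n b B <= hausdorff n (A `|` B).
  move=> a0 b0; pose c := Num.min (Num.min a b) (eps / 2)%R.
  have c0 : (0 < c)%R by rewrite !lt_min a0 b0 divr_gt0.
  apply: (@le_trans _ _ (hausdorff_pre n c (A `|` B))); last first.
    by apply: ereal_sup_ubound; exists c.
  apply: le_trans (hausdorff_pre_separated n _ sep); last first.
    by rewrite gt_min; apply/orP; right; rewrite ltr_pdivrMr // ltr_pMr // ltr1n.
  by apply: leeD; apply: le_hausdorff_pre_delta; rewrite !ge_min lexx ?orbT.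
have [AB|ABoo] := eqVneq (hausdorff n (A `|` B)) +oo; first by rewrite AB leey.
have ABfin : hausdorff n (A `|` B) \is a fin_num.
  by rewrite ge0_fin_numE ?hausdorff_ge0 // ltey.
have Bfin b : (0 < b)%R -> hausdorff_pre n b B \is a fin_num.
  move=> b0; rewrite ge0_fin_numE ?hausdorff_pre_ge0 //.
  apply: le_lt_trans (_ : _ <= hausdorff n (A `|` B)) _; last by rewrite ltey.
  apply: (@le_trans _ _ (hausdorff_pre n 1 A + hausdorff_pre n b B)); last exact: main.
  by rewrite leeDr // hausdorff_pre_ge0.
have Hfin : hausdorff n A \is a fin_num.
  rewrite ge0_fin_numE ?hausdorff_ge0 // (@le_lt_trans _ _ (hausdorff n (A `|` B))) ?ltey //.
  exact/le_hausdorff.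
rewrite addeC -leeBrDr //; apply: ge_ereal_sup => _ [b /= b0 <-].
rewrite leeBrDr // addeC -leeBrDr ?Bfin //.
by apply: ge_ereal_sup => _ [a /= a0 <-]; rewrite leeBrDr ?Bfin // main.
Qed.

End HausdorffMetric.

Section MetricOuterMeasure.
Context {R : realType} {d : nat}.
Variable mu : {outer_measure set 'rV[R]_d -> \bar R}.
Local Open Scope ereal_scope.
Hypothesis mu_separated : forall (eps : R) (A B : set 'rV[R]_d), (0 < eps)%R ->
  (forall x y, A x -> B y -> (eps <= enorm (x - y))%R) ->
  mu A + mu B <= mu (A `|` B).

(** Openness with respect to the balls [eball], stated directly so as not to compare
    it with the topology of the sup norm. *)
Definition eopen (O : set 'rV[R]_d) := forall x, O x ->
  exists2 eps : R, (0 < eps)%R & eball x eps `<=` O.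

(** Caratheodory's criterion. The points of [X `&` O] at depth more than
    [1 / (k + 1)] in [O] form sets [A k]; the layers [A k.+2 `\` A k.+1] are
    separated from [A k], so their measures have a bounded sum and the layers
    beyond [A J] become negligible. *)
Lemma eopen_caratheodory O : eopen O -> mu.-caratheodory O.
Proof.
move=> oO; apply: le_caratheodory_measurable => X.
have [->|Xoo] := eqVneq (mu X) +oo; first by rewrite leey.
have Xfin : mu X \is a fin_num by rewrite ge0_fin_numE ?outer_measure_ge0 // ltey.
pose s k : R := k.+1%:R^-1%R.
have s0 k : (0 < s k)%R by rewrite invr_gt0 ltr0n.
have sS k : (0 < s k - s k.+1)%R.
  by rewrite subr_gt0 ltf_pV2 ?posrE ?ltr0n // ltr_nat.
pose A k := X `&` [set x | eball x (s k) `<=` O].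
have Asub k : A k `<=` X `&` O.
  by move=> x [Xx xO]; split => //; apply: xO; rewrite /eball /= subrr enorm0.
have AS k : A k `<=` A k.+1.
  move=> x [Xx xO]; split => // y /= xy; apply: xO => /=.
  by apply: lt_trans xy _; rewrite -subr_gt0.
have Asep k x y : A k x -> (X `\` A k.+1) y -> (s k - s k.+1 <= enorm (x - y))%R.
  move=> [Xx xO] [Xy nAy]; rewrite leNgt; apply/negP => xy; apply: nAy.
  split => // z /= yz; apply: xO => /=.
  by apply: le_lt_trans (enorm_triangle y _ _) _; move: yz; rewrite eballE; lra.
pose D k := A k.+1 `\` A k.
have AD k : mu (A k) + mu (D k.+1) <= mu (A k.+2).
  apply: le_trans (mu_separated (sS k) _) _.
    by move=> x y Ax [[Xy _] Dy]; apply: (Asep k).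
  by apply: le_outer_measure => x [/AS/AS//|[]].
have AX k : mu (A k) <= mu X by apply: le_outer_measure => x [].
have sumD J : \sum_(k < J) mu (D k.+1) <= mu (A J) + mu (A J.+1).
  elim: J => [|J IH]; first by rewrite big_ord0 adde_ge0 ?outer_measure_ge0.
  rewrite big_ord_recr /=; apply: le_trans (leeD2r _ IH) _.
  by rewrite addeAC addeC leeD2l.
have tail (eps : R) : (0 < eps)%R -> exists J, mu (X `&` O) <= mu (A J) + eps%:E.
  move=> eps0.
  have [J JP] : exists J, mu (\bigcup_(k in ~` `I_J) D k.+1) <= eps%:E.
    apply: (@outer_measure_small_tail _ _ _ _ (fine (mu X) + fine (mu X))) => // J.
    by apply: le_trans (sumD J) _; rewrite EFinD fineK // leeD.
  exists J.+1; apply: le_trans (_ : _ <= mu (A J.+1 `|` \bigcup_(k in ~` `I_J) D k.+1)) _.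
    apply: le_outer_measure => x [Xx Ox].
    have [eps' e0 xeps] := oO _ Ox.
    have [k Ak] : exists k, A k x.
      exists (Num.bound eps'^-1%R); split => // y /= xy; apply: xeps => /=.
      apply: lt_trans xy _; rewrite /s invf_plt ?posrE ?ltr0n //.
      apply: lt_trans (archi_boundP _) _; last by rewrite ltr_nat.
      by rewrite invr_ge0 ltW.
    have [k0 Ak0 kmin] := ex_minnP (ex_intro (fun k => `[< A k x >]) k (asboolT Ak)).
    have [kJ|Jk] := leqP k0 J.+1.
      left; move/asboolP: Ak0; rewrite -(subnKC kJ).
      elim: (J.+1 - k0)%N => [|m IH]; rewrite ?addn0 // addnS => /IH; exact: AS.
    right; exists k0.-2; first by apply/negP => /=; lia.
    rewrite /D (_ : k0.-2.+2 = k0); last by lia.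
    split; first exact/asboolP.
    by move/asboolT/kmin; lia.
  by apply: le_trans (outer_measureU2 _ _ _) _; rewrite leeD2l.
apply/lee_addgt0Pr => eps eps0; have [J JP] := tail _ eps0.
rewrite -setDE; apply: le_trans (leeD2r _ JP) _.
rewrite addeAC leeD2r //; apply: le_trans (mu_separated (sS J) _) _.
  by move=> x y Ax [Xy nO]; apply: (Asep J) => //; split => // /Asub[].
by apply: le_outer_measure => x [[]|[]].
Qed.

End MetricOuterMeasure.

Lemma hausdorff_eopen {R : realType} {d : nat} n (O : set 'rV[R]_d) :
  eopen O -> (hausdorff n : set 'rV[R]_d -> \bar R).-caratheodory O.
Proof. by apply: eopen_caratheodory => eps A B; exact: hausdorff_separated. Qed.

Lemma eball_eopen {R : realType} {d : nat} (x : 'rV[R]_d) r : eopen (eball x r).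
Proof.
move=> y /= xy; exists (r - enorm (x - y)); first by rewrite subr_gt0.
move=> z /= yz; apply: le_lt_trans (enorm_triangle y _ _) _. move: xy yz; rewrite !eballE; lra.
Qed.

(** * Energy integrals over dyadic scales *)

Section Energy.
Context {R : realType} {d : nat}.
Local Open Scope ereal_scope.
Let leb := @lebesgue_measure R.

(** The integral of a nonnegative function is a supremum over the simple functions
    below it, hence it is monotone even on non-measurable functions. *)
Lemma ge0_le_integral_nomeas (D : set R) (f g : R -> \bar R) :
  (forall t, D t -> 0 <= f t) -> (forall t, D t -> f t <= g t) ->
  \int[leb]_(t in D) f t <= \int[leb]_(t in D) g t.
Proof.
move=> f0 fg; rewrite !ge0_integralE //; last by move=> t Dt; rewrite (le_trans (f0 t Dt)) ?fg.
apply: ereal_sup_le => _ [h /= hf <-]; exists h => // t.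
apply: le_trans (hf t) _; rewrite /patch; case: ifPn => //.
by rewrite inE => /fg.
Qed.

Let inv_sqr (a t : R) : R := (a * (t ^+ 2)^-1)%R.

Lemma inv_sqr_within_continuous (a : R) : (0 < a)%R ->
  {within `[a, +oo[, continuous (inv_sqr a)}.
Proof.
move=> a0; apply: continuous_in_subspaceT => t; rewrite inE /= in_itv /= andbT => a_t.
apply: cvgMl_tmp; apply: cvgV; last exact: exprn_continuous.
by rewrite expf_neq0 // gt_eqF // (lt_le_trans a0).
Qed.

Lemma measurable_inv_sqr (a : R) : (0 < a)%R -> measurable_fun `[a, +oo[ (inv_sqr a).
Proof.
by move=> a0; apply: subspace_continuous_measurable_fun => //; exact: inv_sqr_within_continuous.
Qed.

Lemma integral_inv_sqr (a : R) : (0 < a)%R ->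
  \int[leb]_(t in `[a, +oo[) (inv_sqr a t)%:E = 1.
Proof.
move=> a0.
have dF (t : R) : (a < t)%R -> is_derive t 1%R (fun u : R => - a * u^-1)%R (inv_sqr a t).
  move=> a_t; have t0 : t != 0%R by rewrite gt_eqF // (lt_trans a0).
  have D := is_deriveZ (- a)%R (is_deriveV t0 (is_derive_id t (1%R : R))).
  apply: is_derive_eq D _.
  by rewrite /inv_sqr /GRing.scale /= mulr1 mulrNN.
rewrite (@ge0_continuous_FTC2y _ _ (fun u => - a * u^-1)%R _ 0%R) //.
- by rewrite mulNr divff ?gt_eqF // EFinN oppeK add0e.
- by move=> t a_t; rewrite mulr_ge0 ?invr_ge0 ?sqr_ge0 // ltW.
- exact: inv_sqr_within_continuous.
- rewrite -[X in _ --> X](mulr0 (- a)%R); apply: cvgMl_tmp.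
  have pos : \forall u \near +oo%R, (0 < (id u : R))%R by exists 0%R; split.
  by have [_ h] := gtr0_cvgV0 pos; apply: h; exact: cvg_id.
- by move=> t /dF[].
- apply: cvg_at_right_filter; apply: cvgMl_tmp; apply: inv_continuous.
  by rewrite gt_eqF.
- by move=> t; rewrite in_itv /= andbT => /dF[_ <-]; rewrite derive1E.
Qed.

Lemma integral_inv_sqr_restrict_le (a r : R) : (0 < a)%R ->
  \int[leb]_(t in `]0%R, r[) ((EFin \o inv_sqr a) \_ `[a, +oo[) t <= 1.
Proof.
move=> a0; rewrite -integral_mkcondr -(integral_inv_sqr a0).
apply: ge0_subset_integral => //=.
- by apply: measurableI.
- by apply/measurable_EFinP; exact: measurable_inv_sqr.
- by move=> t; rewrite in_itv /= andbT => a_t; rewrite lee_fin mulr_ge0 ?invr_ge0 ?sqr_ge0 // ltW.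
Qed.

Lemma dyadic_scale (b t : R) : (0 < t)%R -> (t < b)%R ->
  exists k, (b / 2 ^+ k.+1 <= t < b / 2 ^+ k)%R.
Proof.
move=> t0 tb.
have [m bm] : exists m, (b / 2 ^+ m <= t)%R.
  exists (Num.bound (b / t)); rewrite ler_pdivrMr ?exprn_gt0 // mulrC -ler_pdivrMr //.
  apply: ltW; apply: lt_trans (archi_boundP _) _.
    by rewrite divr_ge0 ?ltW // (lt_trans t0).
  by rewrite -natrX ltr_nat ltn_expl.
have [k kP kmin] := ex_minnP (ex_intro (fun m => b / 2 ^+ m <= t)%R m bm).
case: k kP kmin => [|k] kP kmin.
  by move: kP; rewrite expr0 divr1 leNgt tb.
exists k; rewrite kP /= ltNge; apply/negP => /kmin; by rewrite ltnn.
Qed.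

(** The power [p] is disposed of by [y `^ p <= y] for [y = (a / t) ^+ n <= 1]. *)
Lemma energy_integrand_le (u : \bar R) (n : nat) (p a t C : R) :
  (0 < n)%N -> (1 <= p)%R -> (0 < C)%R -> (0 < a)%R -> (a <= t)%R ->
  0 <= u -> u <= (C * (2 * a) ^+ n)%:E ->
  (u * (t ^- n)%:E) `^ p * (t^-1)%:E <= ((C * 2 ^+ n) `^ p * inv_sqr a t)%:E.
Proof.
move=> n0 p1 C0 a0 a_t u0 uC; have t0 : (0 < t)%R by exact: lt_le_trans a_t.
have p0 : (0 <= p)%R by rewrite (le_trans ler01).
have at0 : (0 <= a / t)%R by rewrite divr_ge0 // ltW.
have at1 : (a / t <= 1)%R by rewrite ler_pdivrMr // mul1r.
have qle : ((a / t) ^+ n <= 1)%R by exact: exprn_ile1.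
have q0 : (0 < (a / t) ^+ n)%R by rewrite exprn_gt0 // divr_gt0.
have tn : (0 <= t ^- n)%R by rewrite invr_ge0 exprn_ge0 // ltW.
case: u u0 uC => [u| |] //; rewrite !lee_fin => u0 uC.
rewrite /inv_sqr expr2 invfM !mulrA.
rewrite ler_wpM2r ?invr_ge0 ?(ltW t0) //.
apply: (@le_trans _ _ ((C * 2 ^+ n * (a / t) ^+ n) `^ p)%R).
  apply: ge0_ler_powR => //; rewrite ?nnegrE ?mulr_ge0 ?(ltW C0) ?exprn_ge0 ?(ltW q0) //.
  apply: le_trans (ler_wpM2r tn uC) _.
  by rewrite expr_div_n exprMn !mulrA.
rewrite powRM ?mulr_ge0 ?exprn_ge0 ?(ltW C0) ?(ltW q0) //.
rewrite -mulrA ler_wpM2l ?powR_ge0 //.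
apply: le_trans (ge1r_powR _ p1) _; first by rewrite q0 qle.
by rewrite -[leRHS]expr1 ler_wiXn2l.
Qed.

(** With [a = r / 2 ^ k.+1], the integrand at [t >= a] is at most a constant times
    [(a / t) ^ (n p) / t], hence times [a / t ^ 2] because [n p >= 1]; the integral
    of the latter over [t >= a] is 1, whatever the scale [k]. *)
Lemma energy_integral_le (f : R -> \bar R) (n : nat) (p r C : R) (s : seq nat) :
  (0 < n)%N -> (1 <= p)%R -> (0 < C)%R -> (0 < r)%R ->
  (forall t, 0 <= f t) ->
  (forall t, (0 < t < r)%R -> f t = 0 \/ exists2 k, k \in s &
     (r / 2 ^+ k.+1 <= t)%R /\ f t <= (C * (r / 2 ^+ k) ^+ n)%:E) ->
  \int[leb]_(t in `]0%R, r[) ((f t * (t ^- n)%:E) `^ p * (t^-1)%:E)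
    <= ((C * 2 ^+ n) `^ p * (size s)%:R)%:E.
Proof.
move=> n0 p1 C0 r0 f0 fs.
set A := ((C * 2 ^+ n) `^ p)%R.
have A0 : (0 <= A)%R by exact: powR_ge0.
pose a k : R := (r / 2 ^+ k.+1)%R.
have a0 k : (0 < a k)%R by rewrite divr_gt0 // exprn_gt0.
pose h k t := (((fun t => (A * inv_sqr (a k) t)%:E) \_ `[a k, +oo[) t : \bar R).
have h0 k t : 0 <= h k t.
  rewrite /h /patch; case: ifP => // _.
  rewrite lee_fin !mulr_ge0 ?invr_ge0 ?sqr_ge0 //; exact: ltW.
have mh k : measurable_fun setT (h k).
  apply/(measurable_restrictT _ _).1 => //; apply/measurable_EFinP.
  by apply: measurable_funM => //; exact: measurable_inv_sqr.
have int0 t : (0 < t < r)%R -> 0 <= (f t * (t ^- n)%:E) `^ p * (t^-1)%:E.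
  by move=> /andP[t0 _]; rewrite mule_ge0 ?poweR_ge0 // lee_fin invr_ge0 ltW.
apply: le_trans (@ge0_le_integral_nomeas _ _ (fun t => \sum_(k <- s) h k t) _ _) _.
- by move=> t; rewrite /= in_itv /=; exact: int0.
- move=> t /=; rewrite in_itv /= => tr; have [ft|[k ks [akt ft]]] := fs _ tr.
    rewrite ft mul0e poweR0r ?mul0e ?sume_ge0 //.
    by rewrite gt_eqF // (lt_le_trans ltr01).
  rewrite (perm_big _ (perm_to_rem ks)) big_cons; apply: le_trans (leeDl _ _); last first.
    by rewrite sume_ge0.
  rewrite /h /patch ifT; last by rewrite inE /= in_itv /= andbT.
  apply: energy_integrand_le => //.
  apply: le_trans ft _; rewrite lee_fin ler_pM2l // /a exprS invfM.
  by rewrite mulrCA mulVKf.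
rewrite ge0_integral_sum //; last by move=> k; exact: measurable_funS (mh k).
rewrite -[in leRHS](@card_ord (size s)) mulr_natr.
have one k : \int[leb]_(t in `]0%R, r[) h k t <= A%:E.
  have -> : h k = (fun t => A%:E * ((EFin \o inv_sqr (a k)) \_ `[a k, +oo[) t).
    apply/funext => t; rewrite /h /patch; case: ifP => _ //=.
    by rewrite mule0.
  rewrite ge0_integralZl_EFin //.
  - by rewrite -[leRHS]mule1 lee_wpmul2l ?lee_fin // integral_inv_sqr_restrict_le.
  - move=> t _; rewrite /patch; case: ifP => // _.
    by rewrite lee_fin !mulr_ge0 ?invr_ge0 ?sqr_ge0 // ltW.
  - apply: measurable_funS (@measurableT _ _) (@subsetT _ _) _ => //.
    apply/(measurable_restrictT _ _).1 => //; apply/measurable_EFinP.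
    exact: measurable_inv_sqr.
rewrite card_ord; elim: (s) => [|k s' IH]; first by rewrite big_nil mulr0n.
by rewrite big_cons /= mulrS EFinD leeD.
Qed.

(** A lower bound on a dyadic interval of arguments costs a fixed amount of
    energy, and the intervals of distinct scales are disjoint. *)
Lemma energy_integral_ge (f : R -> \bar R) (n : nat) (p r C : R) (s : seq nat) :
  (1 <= p)%R -> (0 < C)%R -> (0 < r)%R -> uniq s ->
  (forall t, 0 <= f t) ->
  (forall k t, k \in s -> (r / 2 ^+ k.+1 <= t < r / 2 ^+ k)%R ->
     (C * t ^+ n)%:E <= f t) ->
  (C `^ p / 2 * (size s)%:R)%:E <=
    \int[leb]_(t in `]0%R, r[) ((f t * (t ^- n)%:E) `^ p * (t^-1)%:E).
Proof.
move=> p1 C0 r0 us f0 fs.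
pose b k : R := (r / 2 ^+ k)%R.
have b0 k : (0 < b k)%R by rewrite divr_gt0 // exprn_gt0.
have bS k : b k.+1 = (b k / 2)%R by rewrite /b exprSr invfM mulrA.
have br k : (b k <= r)%R.
  rewrite ler_pdivrMr ?exprn_gt0 // ler_peMr ?exprn_ege1 ?ler1n //.
  exact: ltW.
have b_le j k : (j <= k)%N -> (b k <= b j)%R.
  by move=> jk; rewrite ler_pM2l // lef_pV2 ?posrE ?exprn_gt0 // ler_weXn2l ?ler1n.
pose I k := [set` `[b k.+1, b k[].
pose w k : R := (C `^ p / b k)%R.
have w0 k : (0 <= w k)%R by rewrite divr_ge0 ?powR_ge0 // ltW.
pose h k (t : R) : \bar R := (w k)%:E * (\1_(I k) t)%:E.
have h0 k t : 0 <= h k t by rewrite mule_ge0 // lee_fin.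
have mI k : measurable (I k) by exact: measurable_itv.
have mh k : measurable_fun setT (h k).
  by apply: emeasurable_funM => //; apply/measurable_EFinP; exact: measurable_indic.
have hI k t : ~ I k t -> h k t = 0.
  by move=> nI; rewrite /h indicE memNset // mule0.
have le_int : \int[leb]_(t in `]0%R, r[) (\sum_(k <- s) h k t) <=
    \int[leb]_(t in `]0%R, r[) ((f t * (t ^- n)%:E) `^ p * (t^-1)%:E).
  apply: ge0_le_integral_nomeas => t; rewrite /= in_itv /= => /andP[t0 tr].
    by rewrite sume_ge0.
  have rhs0 : 0 <= (f t * (t ^- n)%:E) `^ p * (t^-1)%:E.
    by rewrite mule_ge0 ?poweR_ge0 // lee_fin invr_ge0 ltW.
  have [[k ks Ik]|no] := pselect (exists2 k, k \in s & I k t); last first.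
    rewrite big_seq big1 // => k ks; apply: hI => Ik; apply: no; by exists k.
  rewrite (bigD1_seq k) //= big_seq_cond big1 ?adde0 => [|j /andP[js jk]]; last first.
    apply: hI; move: Ik; rewrite /I /= !in_itv /= => /andP[k1 k2] /andP[j1 j2].
    move: jk; rewrite neq_ltn => /orP[] /b_le; rewrite leNgt => /negP; apply.
      exact: le_lt_trans k2.
    exact: le_lt_trans j2.
  have := Ik; rewrite {1}/I /= in_itv /= => kt.
  have Cf := fs _ _ ks kt.
  rewrite /h indicE mem_set // mule1 /w EFinM.
  apply: lee_pmul; rewrite ?lee_fin ?powR_ge0 ?invr_ge0 ?(ltW (b0 k)) //; last first.
    by rewrite lef_pV2 ?posrE // ltW; case/andP: kt.
  rewrite -poweR_EFin; apply: gt0_ler_poweR.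
  - by rewrite (le_trans ler01).
  - by rewrite in_itv /= lee_fin (ltW C0) leey.
  - by rewrite in_itv /= leey andbT mule_ge0 // lee_fin invr_ge0 exprn_ge0 // ltW.
  rewrite (_ : C = (C * t ^+ n) * t ^- n)%R; last by rewrite mulfK // gt_eqF // exprn_gt0.
  by rewrite EFinM lee_wpmul2r // lee_fin invr_ge0 exprn_ge0 // ltW.
apply: le_trans le_int.
rewrite ge0_integral_sum //; last by move=> k; exact: measurable_funS (mh k).
have one k : \int[leb]_(t in `]0%R, r[) h k t = (C `^ p / 2)%:E.
  rewrite ge0_integralZl_EFin //; last first.
    apply/measurable_EFinP; apply: measurable_indic; exact: mI.
  have -> : \int[leb]_(t in `]0%R, r[) (\1_(I k) t)%:E = leb (I k `&` `]0%R, r[).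
    by apply: integral_indic; [exact: measurable_itv|exact: mI].
  have -> : I k `&` `]0%R, r[ = I k.
    apply/seteqP; split => [t []//|t Ik]; split => //.
    move: Ik; rewrite /I /= !in_itv /= => /andP[k1 k2].
    by rewrite (lt_le_trans (b0 _) k1) (lt_le_trans k2).
  rewrite /leb lebesgue_measure_itv /= lte_fin bS.
  have bk : (b k / 2 < b k)%R by rewrite ltr_pdivrMr // ltr_pMr // ltr1n.
  rewrite bk -EFinB -EFinM /w; congr EFin.
  by have := b0 k => bk0; field; rewrite gt_eqF.
under eq_bigr do rewrite one.
elim: (s) => [|k s' IH]; first by rewrite big_nil mulr0.
by rewrite big_cons /= -(@natr1 _ (size s')) mulrDr mulr1 addrC EFinD leeD2l.
Qed.

End Energy.

(** * Lipschitz graphs, grid colourings and packing in regular sets *)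

Section LipschitzGraphs.
Context {R : realType} {d : nat}.
Implicit Types (x y z u v w : 'rV[R]_d) (A : set 'rV[R]_d).

(** McShane's formula [inf_a (h a + L |u - a|)]. *)
Lemma lipschitz_extension_scalar A (h : 'rV[R]_d -> R) (L : R) :
  0 <= L -> A !=set0 ->
  (forall u v, A u -> A v -> h u - h v <= L * enorm (u - v)) ->
  exists g : 'rV[R]_d -> R, (forall u, A u -> g u = h u) /\
    forall u v, g u - g v <= L * enorm (u - v).
Proof.
move=> L0 [a0 Aa0] hL.
pose S u := [set h a + L * enorm (u - a) | a in A].
have S0 u : S u !=set0 by exists (h a0 + L * enorm (u - a0)); exists a0.
have lbS u b : A b -> lbound (S u) (h b - L * enorm (u - b)).
  move=> Ab _ [a Aa <-]; have := hL _ _ Ab Aa.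
  have : L * enorm (b - a) <= L * enorm (b - u) + L * enorm (u - a).
    by rewrite -mulrDr ler_wpM2l // enorm_triangle.
  rewrite (enormB b u); lra.
have infS u : has_inf (S u) by split => //; exists (h a0 - L * enorm (u - a0)); exact: lbS.
exists (fun u => inf (S u)); split=> [u Au|u v].
  apply/eqP; rewrite eq_le; apply/andP; split.
    by apply: ge_inf; [exact: (infS u).2|exists u => //; rewrite subrr enorm0 mulr0 addr0].
  by apply: lb_le_inf => //; have := lbS u _ Au; rewrite subrr enorm0 mulr0 subr0.
rewrite lerBlDl -lerBlDr; apply: lb_le_inf => // _ [a Aa <-].
have : inf (S u) <= h a + L * enorm (u - a).
  by apply: ge_inf; [exact: (infS u).2|exists a].
have : L * enorm (u - a) <= L * enorm (u - v) + L * enorm (v - a).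
  by rewrite -mulrDr ler_wpM2l // enorm_triangle.
lra.
Qed.

Lemma lipschitz_extension A (f : 'rV[R]_d -> 'rV[R]_d) (L : R) :
  0 <= L -> A !=set0 ->
  (forall u v, A u -> A v -> enorm (f u - f v) <= L * enorm (u - v)) ->
  exists g : 'rV[R]_d -> 'rV[R]_d, (forall u, A u -> g u = f u) /\
    forall u v, enorm (g u - g v) <= d%:R * L * enorm (u - v).
Proof.
move=> L0 A0 fL.
have [G GP] : {G : 'I_d -> 'rV[R]_d -> R & forall i,
    (forall u, A u -> G i u = f u 0 i) /\
    forall u v, G i u - G i v <= L * enorm (u - v)}.
  apply: (@choice _ _ (fun i g => (forall u, A u -> g u = f u 0 i) /\
    forall u v, g u - g v <= L * enorm (u - v))) => i.
  apply: lipschitz_extension_scalar => // u v Au Av; apply: le_trans (fL _ _ Au Av).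
  have := enorm_coord (f u - f v) i; rewrite !mxE; apply: le_trans.
  exact: ler_norm.
exists (fun u => \row_i G i u); split=> [u Au|u v].
  by apply/rowP => i; rewrite mxE (GP i).1.
rewrite -mulrA; apply: enorm_le_coord => i; rewrite !mxE ler_norml.
by rewrite (GP i).2 andbT lerNl opprB enormB (GP i).2.
Qed.

(** A set without pairs in the cone about [V] is a graph over the orthogonal
    complement of [V], on which it projects injectively with a Lipschitz
    inverse. *)
Lemma cone_free_subset_graph (n : nat) (V : {vspace 'rV[R]_d}) (beta : R) A :
  (n <= d)%N -> 0 < beta -> Gr (d - n) V ->
  (forall x y v, A x -> A y -> v \in V ->
    beta * enorm (x - y) <= enorm (x - y - v)) ->
  exists2 Gamma, lipschitz_graph n (d%:R / beta) Gamma & A `<=` Gamma.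
Proof.
move=> nd beta0 dV Afree; have [W [dW WP VW]] := orthocompl_vspace V.
have [pr prP] : {pr : 'rV[R]_d -> 'rV[R]_d & forall u, pr u \in W /\ u - pr u \in V}.
  by apply: (@choice _ _ (fun u w => w \in W /\ u - w \in V)) => u; case: (VW u) => w; exists w.
have WV w v : w \in W -> v \in V -> edot v w = 0 by move=> /WP + vV; rewrite edotC; exact.
have piV v : v \in V -> pr v = 0.
  move=> vV; have [pW pV] := prP v; apply: edotvv_eq0; apply: WV => //.
  by rewrite -[pr v](subKr v) rpredB.
have le_pi x y : enorm (x - pr x - (y - pr y)) <= enorm (x - y).
  have -> : x - y = x - pr x - (y - pr y) + (pr x - pr y).
    by apply/rowP => i; rewrite !mxE; ring.
  apply: orthogonal_enorm_le; apply: WV; rewrite rpredB //.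
  - exact: (prP x).1.
  - exact: (prP y).1.
  - exact: (prP x).2.
  - exact: (prP y).2.
have GrW : Gr n W by rewrite /Gr /= dW dV subKn.
have [->|/set0P[a0 Aa0]] := eqVneq A set0.
  exists [set v + 0 | v in [set` W]] => //; exists W, (fun=> 0); split => //.
  - by move=> v _ w _; rewrite /edot big1 // => i _; rewrite mxE mul0r.
  - move=> v w _ _; rewrite subrr enorm0 mulr_ge0 ?enorm_ge0 //.
    by rewrite divr_ge0 // ltW.
have piA x y : A x -> A y -> beta * enorm (x - y) <= enorm (pr x - pr y).
  move=> Ax Ay; have -> : pr x - pr y = x - y - (x - pr x - (y - pr y)).
    by apply/rowP => i; rewrite !mxE; ring.
  by apply: Afree => //; rewrite rpredB // ?(prP x).2 ?(prP y).2.
have [f fP] : {f : 'rV[R]_d -> 'rV[R]_d & forall x, A x -> f (pr x) = x}.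
  suff [f fP] : {f : 'rV[R]_d -> 'rV[R]_d & forall w, (exists2 x, A x & pr x = w) ->
      A (f w) /\ pr (f w) = w}.
    exists f => x Ax; have [Af pf] := fP _ (ex_intro2 _ _ x Ax erefl).
    apply/eqP; rewrite -subr_eq0; apply/eqP/edotvv_eq0; rewrite -sqr_enorm.
    have := piA _ _ Af Ax; rewrite pf subrr enorm0 pmulr_rle0 // => le0.
    have -> : enorm (f (pr x) - x) = 0 by apply/eqP; rewrite eq_le le0 enorm_ge0.
    by rewrite expr0n.
  apply: (@choice _ _ (fun w x => (exists2 x, A x & pr x = w) -> A x /\ pr x = w)) => w.
  have [[x Ax xw]|no] := pselect (exists2 x, A x & pr x = w); first by exists x.
  by exists 0.
(* [w + (f w - w)] is the point over [w]; the extension [g] of [f w - w] is made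
   vertical again by removing its component in [W] *)
have binv0 : 0 <= beta^-1 by rewrite invr_ge0 ltW.
have [g [gf gL]] := @lipschitz_extension (pr @` A) (fun w => f w - w) beta^-1 binv0
  ltac:(by exists (pr a0); exists a0) ltac:(
  move=> _ _ [x Ax <-] [y Ay <-]; rewrite !fP //; apply: le_trans (le_pi x y) _;
  by rewrite ler_pdivlMl // piA).
exists [set v + (g v - pr (g v)) | v in [set` W]].
  exists W, (fun v => g v - pr (g v)); split => //.
  - by move=> v vW w wW; apply: WV => //; exact: (prP _).2.
  - by move=> v w _ _; apply: le_trans (le_pi _ _) (gL _ _).
move=> x Ax; exists (pr x); first exact: (prP x).1.
have gx : g (pr x) = x - pr x by rewrite gf ?fP //; exists x.
have px : pr (x - pr x) = 0 by apply: piV; exact: (prP x).2.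
by rewrite /= gx px subr0 addrC subrK.
Qed.

(** Cubes of side [b / (4 d)], coloured by their coordinates modulo [4 d + 1]:
    points of one colour are in a common cube, or in cubes more than [4 d] sides
    apart. *)
Lemma grid_colouring (b : R) : (0 < d)%N -> 0 < b ->
  exists col : 'rV[R]_d -> {ffun 'I_d -> 'I_(4 * d).+1}, forall x y,
    col x = col y -> enorm (x - y) <= b / 4 \/ b <= enorm (x - y).
Proof.
move=> d0 b0; have dR0 : 0 < d%:R :> R by rewrite ltr0n.
pose s : R := b / (4 * d%:R); have s0 : 0 < s by rewrite divr_gt0 // mulr_gt0.
pose fl x i := Num.floor (x 0 i / s : R).
exists (fun x => [ffun i => inord `|(fl x i %% (4 * d).+1%:Z)%Z|%N]) => x y /ffunP xy.
have eqmod i : (fl x i = fl y i %[mod (4 * d).+1%:Z])%Z.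
  have := xy i; rewrite !ffunE => /(congr1 val).
  have lt u : (`|(fl u i %% (4 * d).+1%:Z)%Z|%N < (4 * d).+1)%N.
    have := ltz_pmod (fl u i) (isT : 0 < (4 * d).+1%:Z).
    by have := modz_ge0 (fl u i) (isT : (4 * d).+1%:Z != 0); lia.
  rewrite /= !inordK //.
  have := modz_ge0 (fl x i) (isT : (4 * d).+1%:Z != 0).
  by have := modz_ge0 (fl y i) (isT : (4 * d).+1%:Z != 0); lia.
have flP u i : (fl u i)%:~R * s <= u 0 i < ((fl u i)%:~R + 1) * s.
  rewrite -ler_pdivlMr // -ltr_pdivrMr //.
  by have /andP[-> h] := floor_itv (u 0 i / s); move: h; rewrite intrD.
have [same|] := pselect (forall i, fl x i = fl y i).
  left; have -> : b / 4 = d%:R * s by rewrite /s; field; rewrite gt_eqF.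
  apply: enorm_le_coord => i; rewrite !mxE ler_norml.
  have := flP x i; have := flP y i; rewrite same => /andP[? ?] /andP[? ?]; lra.
move=> /existsNP[i /eqP ni]; right.
have : ((4 * d).+1%:Z <= `|fl x i - fl y i|)%R.
  have : ((4 * d).+1%:Z %| fl x i - fl y i)%Z by rewrite -eqz_mod_dvd; apply/eqP.
  move=> /dvdzP[q qE]; have q0 : q != 0.
    by apply: contraNneq ni => q0; rewrite -subr_eq0 qE q0 mul0r.
  rewrite qE normrM; have : 1 <= `|q| by lia.
  nia.
rewrite -(ler_int R) intr_norm intrB => h.
apply: le_trans (enorm_coord (x - y) i); rewrite !mxE.
have bs : b = (4 * d)%:R * s by rewrite natrM /s; field; rewrite gt_eqF.
have h2 : (4 * d)%:R + 1 <= `|(fl x i)%:~R - (fl y i)%:~R| :> R.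
  by apply: le_trans h; rewrite natr1 -pmulrn.
have /andP[x1 x2] := flP x i; have /andP[y1 y2] := flP y i.
rewrite bs ler_normr; apply/orP; case: ger0P h2 => _ h2; [left|right].
  by have := ler_wpM2r (ltW s0) h2; lra.
by have := ler_wpM2r (ltW s0) h2; lra.
Qed.

End LipschitzGraphs.

Section ADRPacking.
Context {R : realType} {d : nat}.
Implicit Types (x y z : 'rV[R]_d) (E A X Gamma : set 'rV[R]_d).

Lemma lt_diam A (r : R) : 0 <= r -> (r%:E < diam A)%E ->
  exists x y, [/\ A x, A y & r < enorm (x - y)].
Proof.
move=> r0; rewrite /diam lt_max => /orP[|].
  by rewrite lte_fin => /(le_lt_trans r0); rewrite ltxx.
by move=> /ereal_sup_gt[_ [x Ax [y Ay <-]]]; rewrite lte_fin => h; exists x, y.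
Qed.

Lemma diam_gt A (r : R) x y : A x -> A y -> r < enorm (x - y) -> (r%:E < diam A)%E.
Proof.
move=> Ax Ay rxy; apply: (@lt_le_trans _ _ (enorm (x - y))%:E); first by rewrite lte_fin.
exact: le_enorm_diam.
Qed.

Variables (n : nat) (E : set 'rV[R]_d) (C0 C1 : R).
Hypotheses (C00 : 0 < C0) (C10 : 0 < C1).
Hypothesis adrE : forall x (r : R), E x -> 0 < r -> (r%:E < diam E)%E ->
  ((C0 * r ^+ n)%:E <= hausdorff n (E `&` eball x r) <= (C1 * r ^+ n)%:E)%E.

Lemma ADR_lower x (r : R) : E x -> 0 < r -> (r%:E < diam E)%E ->
  ((C0 * r ^+ n)%:E <= hausdorff n (E `&` eball x r))%E.
Proof. by move=> Ex r0 rE; have /andP[] := adrE Ex r0 rE. Qed.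

Lemma ADR_upper x (r : R) : E x -> 0 < r -> (r%:E < diam E)%E ->
  (hausdorff n (E `&` eball x r) <= (C1 * r ^+ n)%:E)%E.
Proof. by move=> Ex r0 rE; have /andP[] := adrE Ex r0 rE. Qed.

Let separated A (rho : R) (s : seq 'rV[R]_d) :=
  all (fun y => `[< A y >]) s && pairwise (fun y z => 2 * rho <= enorm (y - z)) s.

(** The disjoint balls of radius [rho] about separated points of [E] each carry
    measure at least [C0 rho ^ n]. *)
Lemma size_separated A X (rho : R) s : 0 < rho -> (rho%:E < diam E)%E ->
  A `<=` E -> (forall y, A y -> eball y rho `<=` X) -> separated A rho s ->
  ((C0 * rho ^+ n * (size s)%:R)%:E <= hausdorff n (E `&` X))%E.
Proof.
move=> rho0 rhoE AE AX /andP[/allP sA /(pairwiseP 0) sepn].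
pose O k : set 'rV[R]_d := if (k < size s)%N then eball (nth 0 s k) rho else set0.
have mO k : (hausdorff n : set 'rV[R]_d -> \bar R).-caratheodory (O k).
  apply: hausdorff_eopen; rewrite /O; case: ifP => _; first exact: eball_eopen.
  by move=> x.
have le1 x : (E `&` X) x -> (count_below O (size s) x <= 1)%N.
  move=> _; apply: count_below_spread => i j ij; rewrite /O.
  case: ifP => // iS; case: ifP => [jS|_ _ []]; rewrite !eballE => ix jx.
  have := sepn i j iS jS; rewrite addn1 in ij => /(_ ij).
  rewrite leNgt => /negP; apply.
  apply: le_lt_trans (enorm_triangle x _ _) _.
  by move: jx; rewrite (enormB (nth 0 s j)); lra.
have := sum_outer_measure_le (mu := hausdorff n) mO le1; apply: le_trans.
rewrite -[X in (C0 * _ * X%:R)%R](card_ord (size s)) mulr_natr -sumr_const -sumEFin.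
apply: lee_sum => k _; have sk : nth 0 s k \in s by rewrite mem_nth.
have /asboolP Ak := sA _ sk.
apply: le_trans (ADR_lower (AE _ Ak) rho0 rhoE) _; apply: le_hausdorff => x [Ex kx].
by rewrite /O ltn_ord; split => //; split => //; exact: AX kx.
Qed.

(** A maximal [2 rho]-separated family in [A] is finite and its balls of radius
    [2 b] cover the [b]-neighbourhood of [A]. *)
Lemma hausdorff_neighbourhood_le A X (b rho : R) :
  0 < rho -> 2 * rho <= b -> ((2 * b)%:E < diam E)%E ->
  A `<=` E -> (forall y, A y -> eball y rho `<=` X) ->
  (hausdorff n (E `&` X) < +oo)%E ->
  (hausdorff n (E `&` [set x | exists2 y, A y & (enorm (x - y) < b)%R]) <=
     (C1 * (2 * b) ^+ n / (C0 * rho ^+ n))%:E * hausdorff n (E `&` X))%E.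
Proof.
move=> rho0 rhob bE AE AX Xoo.
have b0 : 0 < b by lra.
have rhoE : (rho%:E < diam E)%E by apply: le_lt_trans bE; rewrite lee_fin; lra.
have Crho : 0 < C0 * rho ^+ n by rewrite mulr_gt0 // exprn_gt0.
have Xfin : hausdorff n (E `&` X) \is a fin_num by rewrite ge0_fin_numE // hausdorff_ge0.
set K := fine (hausdorff n (E `&` X)).
have K0 : 0 <= K by rewrite fine_ge0 // hausdorff_ge0.
have sizeK s : separated A rho s -> C0 * rho ^+ n * (size s)%:R <= K.
  by move=> /(size_separated rho0 rhoE AE AX); rewrite -(fineK Xfin) lee_fin.
pose P m := `[< exists2 s, separated A rho s & size s = m >].
have exP : exists m, P m by exists 0%N; apply/asboolP; exists [::].
have bdP m : P m -> (m <= Num.bound (K / (C0 * rho ^+ n)))%N.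
  move=> /asboolP[s /sizeK sK <-]; rewrite -(ler_nat R).
  apply: le_trans (ltW (archi_boundP _)); last by rewrite divr_ge0 // ltW.
  by rewrite ler_pdivlMr // mulrC.
have [_ /asboolP[s ss <-] smax] := ex_maxnP exP bdP.
have cover y : A y -> exists2 z, z \in s & enorm (z - y) < 2 * rho.
  move=> Ay; apply: contrapT => no.
  suff : P (size s).+1 by move=> /smax; rewrite ltnn.
  apply/asboolP; exists (y :: s) => //; rewrite /separated /=.
  move: ss => /andP[-> ->]; rewrite andbT andbT.
  apply/andP; split; first exact/asboolP.
  apply/allP => z zs; rewrite leNgt enormB; apply/negP => zy.
  by apply: no; exists z.
pose O k : set 'rV[R]_d := E `&` eball (nth 0 s k) (2 * b).
have sub : E `&` [set x | exists2 y, A y & (enorm (x - y) < b)%R] `<=`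
    \big[setU/set0]_(k < size s) O k.
  move=> x [Ex [y Ay xy]]; have [z zs zy] := cover _ Ay.
  rewrite -bigcup_mkord; exists (index z s); first by rewrite /= index_mem.
  rewrite /O nth_index //; split => //; rewrite eballE.
  apply: le_lt_trans (enorm_triangle y _ _) _; rewrite (enormB y x); lra.
apply: le_trans (le_hausdorff n sub) _.
apply: le_trans (outer_measure_subadditive (hausdorff n) _ _) _.
have OC (k : 'I_(size s)) : true -> (hausdorff n (O k) <= (C1 * (2 * b) ^+ n)%:E)%E.
  move=> _; have sk : nth 0 s k \in s by rewrite mem_nth.
  move: ss => /andP[/allP sA _]; have /asboolP Ak := sA _ sk.
  by apply: ADR_upper => //; [exact: AE|rewrite mulr_gt0].
apply: le_trans (lee_sum _ OC) _.
rewrite sumEFin sumr_const card_ord -(fineK Xfin) -EFinM lee_fin -/K.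
rewrite -[leLHS]mulr_natr -[leRHS]mulrA ler_pM2l; last first.
  by rewrite mulr_gt0 // exprn_gt0 // mulr_gt0.
by rewrite ler_pdivlMl // sizeK.
Qed.

End ADRPacking.

(** * From bounded energy to Lipschitz graphs *)

Section ConeFacts.
Context {R : realType} {d : nat}.
Implicit Types (x y z v w : 'rV[R]_d) (E A : set 'rV[R]_d).

Lemma edist_le y A z : A z -> Defs.edist y A <= enorm (y - z).
Proof.
move=> Az; apply: ge_inf; last by exists z.
by exists 0 => _ [u _ <-]; exact: enorm_ge0.
Qed.

Lemma edist_lt y A (c : R) : A !=set0 -> Defs.edist y A < c -> exists2 z, A z & enorm (y - z) < c.
Proof.
move=> [a Aa] /(inf_lt (ex_intro _ (enorm (y - a)) (ex_intro2 _ _ a Aa erefl))).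
by move=> [_ [z Az <-] h]; exists z.
Qed.

Lemma eball_sub_cone (V : {vspace 'rV[R]_d}) (alpha beta rho t : R) x y v :
  0 < beta -> beta <= alpha / 4 -> beta <= 1 / 2 -> v \in V ->
  enorm (x - y - v) < beta * enorm (x - y) -> rho <= beta * enorm (x - y) ->
  enorm (x - y) + rho <= t -> eball y rho `<=` cone x V alpha t.
Proof.
move=> beta0 ba b2 vV xyv rhob tb w; rewrite eballE => yw; split.
  rewrite eballE; apply: le_lt_trans (enorm_triangle y _ _) _; lra.
have Vvx : translate V x (- v + x) by exists (- v) => //=; rewrite rpredN.
apply: le_lt_trans (edist_le w Vvx) _.
have -> : w - (- v + x) = (w - y) - (x - y - v).
  by apply/rowP => i; rewrite !mxE; ring.
apply: le_lt_trans (enormD _ _) _; rewrite enormN (enormB w y).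
have xw : enorm (x - y) <= enorm (x - w) + enorm (y - w).
  by rewrite (enormB y w) enorm_triangle.
have xy0 := enorm_ge0 (x - y); have xw0 := enorm_ge0 (x - w).
have h : enorm (x - y) / 2 <= enorm (x - w) by nra.
have alpha0 : 0 <= alpha by lra.
have := ler_wpM2l alpha0 h; have := ler_wpM2r xy0 ba; lra.
Qed.

(** The lower bound [b / 4] instead of [b / 2] lets the set be open while the scales
    [b / 2 ^ k] still exhaust all distances less than [b]. *)
Definition cone_scale A (V : {vspace 'rV[R]_d}) (beta b : R) : set 'rV[R]_d :=
  [set x | exists y v, [/\ A y, v \in V, b / 4 < enorm (x - y) < b &
    enorm (x - y - v) < beta * enorm (x - y)]].

Lemma cone_scale_eopen A V (beta b : R) : 0 < beta -> beta <= 1 / 2 ->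
  eopen (cone_scale A V beta b).
Proof.
move=> beta0 b2 x [y [v [Ay vV /andP[x1 x2] xyv]]].
pose e := Num.min (Num.min (enorm (x - y) - b / 4) (b - enorm (x - y)))
  ((beta * enorm (x - y) - enorm (x - y - v)) / 2).
have e0 : 0 < e by rewrite !lt_min !subr_gt0 x1 x2 divr_gt0 ?subr_gt0.
have : e <= e by []; rewrite {2}/e !le_min => /andP[/andP[e1 e2] e3].
exists e => // z; rewrite eballE => xz; exists y, v.
have h1 : enorm (x - y) <= enorm (x - z) + enorm (z - y) by exact: enorm_triangle.
have h2 : enorm (z - y) <= enorm (x - z) + enorm (x - y).
  by rewrite (enormB x z) enorm_triangle.
have h3 : enorm (z - y - v) <= enorm (x - z) + enorm (x - y - v).
  have -> : z - y - v = (z - x) + (x - y - v) by rewrite !addrA subrK.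
  by rewrite (enormB x z) enormD.
split => //; first by apply/andP; split; lra.
nra.
Qed.

End ConeFacts.

Section BigPieces.
Context {R : realType} {d : nat}.
Variables (n : nat) (p : R) (E : set 'rV[R]_d) (C0 C1 : R).
Hypotheses (n0 : (0 < n)%N) (nd : (n < d)%N) (p1 : 1 <= p).
Hypotheses (C00 : 0 < C0) (C10 : 0 < C1).
Hypothesis adrE : forall x (r : R), E x -> 0 < r -> (r%:E < diam E)%E ->
  ((C0 * r ^+ n)%:E <= hausdorff n (E `&` eball x r) <= (C1 * r ^+ n)%:E)%E.

Let mu := outer_restr (hausdorff n) E.

Lemma sub_supp x (r : R) : E x -> 0 < r -> (r%:E < diam E)%E -> supp mu x.
Proof.
move=> Ex r0 rE t t0; pose u := Num.min t r.
have u0 : 0 < u by rewrite lt_min t0.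
have uE : (u%:E < diam E)%E by apply: le_lt_trans rE; rewrite lee_fin ge_min lexx orbT.
apply: (@lt_le_trans _ _ (C0 * u ^+ n)%:E).
  by rewrite lte_fin mulr_gt0 // exprn_gt0.
apply: le_trans (ADR_lower adrE Ex u0 uE) _.
rewrite /mu /= /outer_restr setIC; apply: le_hausdorff => y [yu Ey]; split => //.
by move: yu; rewrite !eballE => /lt_le_trans; apply; rewrite ge_min lexx.
Qed.

(** A point [y] of [A] in the cone of [x] at distance about [b] is the centre of a
    ball of radius comparable to [b] that lies in the wider cone of [x] truncated at
    any [t] with [2 b <= t < 4 b]. So each such scale costs a fixed amount of energy;
    the three coarsest scales, where these [t] are not below [r], are counted apart. *)
Lemma count_cone_scale_le A V x (alpha beta r M0 : R) (J : nat) :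
  0 < beta -> beta <= alpha / 4 -> beta <= 1 / 2 -> 0 < r -> (r%:E < diam E)%E ->
  A `<=` E -> (conical_energy n p mu x V alpha r <= M0%:E)%E ->
  (count_below (fun k => cone_scale A V beta (2 * r / 2 ^+ k)) J x <=
    3 + Num.bound (M0 / ((C0 * (beta / 16) ^+ n) `^ p / 2)))%N.
Proof.
move=> beta0 ba b2 r0 rE AE energy.
set c := C0 * (beta / 16) ^+ n; have c0 : 0 < c by rewrite mulr_gt0 // exprn_gt0 // divr_gt0.
have cp0 : 0 < c `^ p / 2 by rewrite divr_gt0 // powR_gt0.
apply: leq_trans (count_below_homo _ _ (leq_addl 3 J)) _.
apply: leq_trans (count_below_shift _ _ _ _) _; rewrite leq_add2l count_below_size.
set s := [seq k <- _ | _].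
have us : uniq s by rewrite filter_uniq // iota_uniq.
have mu_ge0 t : (0 <= mu (cone x V alpha t))%E by exact: outer_restr_ge0.
have : ((c `^ p / 2 * (size s)%:R)%:E <= M0%:E)%E.
  apply: le_trans energy; apply: energy_integral_ge => //.
  move=> k t; rewrite mem_filter => /andP[] /[!inE] xk _ /andP[t1 t2].
  have [y [v [Ay vV /andP[xy1 xy2] xyv]]] := xk.
  pose b : R := 2 * r / 2 ^+ (3 + k).
  have b0 : 0 < b by apply: divr_gt0; [exact: mulr_gt0|exact: exprn_gt0].
  have k4 : r / 2 ^+ k = 4 * b by rewrite /b exprD; field; rewrite expf_neq0.
  have k2 : r / 2 ^+ k.+1 = 2 * b by rewrite /b exprS exprD; field; rewrite expf_neq0.
  rewrite k4 in t2; rewrite k2 in t1; rewrite -/b in xy1 xy2.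
  pose rho := beta * b / 4; have rho0 : 0 < rho by rewrite /rho !mulr_gt0.
  have br : 2 * b <= r.
    rewrite -k2 ler_pdivrMr ?exprn_gt0 // ler_peMr ?exprn_ege1 ?ler1n //; exact: ltW.
  have rhob : rho <= b / 8 by rewrite /rho; nra.
  have rhoE : (rho%:E < diam E)%E by apply: le_lt_trans rE; rewrite lee_fin; lra.
  apply: (@le_trans _ _ (C0 * rho ^+ n)%:E).
    rewrite lee_fin /c -mulrA ler_pM2l // -exprMn ler_pXn2r ?nnegrE //.
    - rewrite /rho; nra.
    - by rewrite mulr_ge0 // ?divr_ge0 //; lra.
    - exact: ltW.
  apply: le_trans (ADR_lower adrE (AE _ Ay) rho0 rhoE) _.
  rewrite /mu /= /outer_restr setIC; apply: le_hausdorff => w [yw Ew]; split => //.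
  apply: (eball_sub_cone (y := y) (v := v) (beta := beta) (rho := rho)) => //.
    by rewrite /rho; nra.
  lra.
rewrite lee_fin => sM; rewrite -(ler_nat R).
apply: le_trans (ltW (archi_boundP _)).
  by rewrite ler_pdivlMr // mulrC.
rewrite divr_ge0 ?(ltW cp0) //; apply: le_trans sM.
by rewrite mulr_ge0 // ltW.
Qed.

Lemma BPBE_BPLG : BPBE n p mu -> BPLG n E.
Proof.
move=> [alpha [kappa [M0 [alpha0 [kappa0 [M00 big]]]]]].
have d0 : (0 < d)%N by exact: leq_trans nd.
pose beta := Num.min (alpha / 4) (1 / 2).
have beta0 : 0 < beta by rewrite lt_min !divr_gt0.
have ba : beta <= alpha / 4 by rewrite ge_min lexx.
have b2 : beta <= 1 / 2 by rewrite ge_min lexx orbT.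
pose M := (3 + Num.bound (M0 / ((C0 * (beta / 16) ^+ n) `^ p / 2)))%N.
pose C := {ffun 'I_d -> 'I_(4 * d).+1}.
pose T := (2 * #|C| ^ M)%N.
have T0 : 0 < T%:R :> R.
  rewrite ltr0n muln_gt0 /= expn_gt0; apply/orP; left.
  by apply/card_gt0P; exists [ffun => ord0].
exists (kappa * C0 / T%:R), (d%:R / beta).
split; first by rewrite divr_gt0 // mulr_gt0.
split; first by rewrite divr_gt0 // ltr0n.
move=> x0 r Ex0 r0 rE.
have suppE x : E x -> supp mu x by move=> Ex; exact: sub_supp Ex r0 rE.
have rsupp : (r%:E < diam (supp mu))%E by apply: lt_le_trans rE (le_diam _).
have [G [V [Gball Gbig dV Gen]]] := big x0 r (suppE _ Ex0) r0 rsupp.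
pose A := G `&` E.
have AE : A `<=` E by move=> x [].
have Abig : ((kappa * C0 * r ^+ n)%:E <= hausdorff n A)%E.
  apply: le_trans Gbig; rewrite -mulrA EFinM lee_pmul2l // ?lte_fin //.
  by rewrite /mu /= /outer_restr setIC; exact: (ADR_lower adrE).
have Aoo : (hausdorff n A < +oo)%E.
  apply: (@le_lt_trans _ _ (C1 * r ^+ n)%:E); last exact: ltry.
  apply: le_trans (ADR_upper adrE Ex0 r0 rE); apply: le_hausdorff.
  by move=> x [/Gball].
pose b k : R := 2 * r / 2 ^+ k.
have b0 k : 0 < b k by apply: divr_gt0; [exact: mulr_gt0|exact: exprn_gt0].
pose O k := cone_scale A V beta (b k).
have mO k : (hausdorff n : set 'rV[R]_d -> \bar R).-caratheodory (O k).
  by apply: hausdorff_eopen; exact: cone_scale_eopen.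
have [col colP] : {col : nat -> 'rV[R]_d -> C & forall k x y, col k x = col k y ->
    enorm (x - y) <= b k / 4 \/ b k <= enorm (x - y)}.
  apply: (@choice _ _ (fun k (f : 'rV[R]_d -> C) => forall x y, f x = f y ->
    enorm (x - y) <= b k / 4 \/ b k <= enorm (x - y))) => k.
  exact: grid_colouring.
have [c cP] := @exists_colour_choice _ _ C (hausdorff n) O col mO A M [ffun => ord0] Aoo
  (fun J x Ax => count_cone_scale_le J beta0 ba b2 r0 rE AE (Gen _ Ax.1)).
pose K := A `&` [set x | forall k, O k x -> col k x = c k].
have [Gamma Gammalip KGamma] : exists2 Gamma, lipschitz_graph n (d%:R / beta) Gamma & K `<=` Gamma.
  apply: (cone_free_subset_graph (V := V)) => //; first exact: ltnW.
  move=> x y v [Ax Kx] [Ay Ky] vV; rewrite leNgt; apply/negP => xyv.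
  have xy0 : 0 < enorm (x - y).
    by rewrite -(pmulr_rgt0 _ beta0); apply: le_lt_trans xyv; exact: enorm_ge0.
  have xyr : enorm (x - y) < 2 * r.
    apply: le_lt_trans (enorm_triangle x0 _ _) _.
    have := Gball _ Ax.1; have := Gball _ Ay.1; rewrite !eballE (enormB x0 x); lra.
  have [k /andP[k1 k2]] := dyadic_scale xy0 xyr.
  have k3 : b k / 4 < enorm (x - y).
    apply: lt_le_trans k1; rewrite exprS invfM mulrA (mulrAC _ _ (2 ^- k)) -/(b k).
    by have := b0 k; lra.
  (* both points see each other at scale [k], so both have the colour [c k] there *)
  have Ox : O k x by exists y, v; rewrite k3 k2.
  have Oy : O k y.
    exists x, (- v); split => //; first by rewrite rpredN.
      by rewrite enormB k3 k2.
    by rewrite -(opprB x y) -opprD !enormN.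
  have := colP k x y; rewrite (Kx _ Ox) (Ky _ Oy) => /(_ erefl)[].
    by rewrite leNgt k3.
  by rewrite leNgt k2.
exists Gamma; split => //.
apply: (@le_trans _ _ (hausdorff n K)); last first.
  apply: le_hausdorff => x Kx; split; last exact: KGamma.
  by case: Kx => [[Gx Ex] _]; split => //; exact: Gball.
move: (le_trans Abig cP); rewrite -/K -/T -mule_natl -lee_pdivrMl //.
by move=> h; apply: le_trans h; rewrite -EFinM lee_fin [leRHS]mulrC mulrAC.
Qed.

End BigPieces.

(** * From Lipschitz graphs to bounded energy *)

Section GraphCones.
Context {R : realType} {d : nat}.
Implicit Types (x y z v w : 'rV[R]_d) (Gamma : set 'rV[R]_d).

Definition nbhd Gamma (c : R) : set 'rV[R]_d :=
  [set y | exists2 z, Gamma z & enorm (y - z) < c].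

Lemma nbhd_eopen Gamma (c : R) : eopen (nbhd Gamma c).
Proof.
move=> y [z Gz yz]; exists (c - enorm (y - z)); first by rewrite subr_gt0.
move=> w; rewrite eballE => yw; exists z => //.
have := enorm_triangle y w z; rewrite (enormB w y); lra.
Qed.

Lemma cone_witness x (V : {vspace 'rV[R]_d}) (alpha t : R) y : cone x V alpha t y ->
  enorm (x - y) < t /\ exists2 v, v \in V & enorm (x - y - v) < alpha * enorm (x - y).
Proof.
move=> [xyt]; have Vx : translate V x !=set0 by exists (0 + x); exists 0 => //=; exact: mem0v.
move=> /(edist_lt Vx)[_ [v vV <-] yv]; split => //; exists (- v); first by rewrite rpredN.
have -> : x - y - - v = v + x - y by apply/rowP => i; rewrite !mxE; ring.
by rewrite (enormB (v + x) y); exact: yv.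
Qed.

(** Seen from a point [x] of the graph, a point [y] in the narrow cone about the
    vertical space hardly moves horizontally, while the points of the graph at
    distance about [|x - y|] from [x] do. *)
Lemma graph_cone_dist (n : nat) (L : R) Gamma : 0 < L -> lipschitz_graph n L Gamma ->
  exists2 V : {vspace 'rV[R]_d}, Gr (d - n) V &
  forall x y z v, Gamma x -> Gamma z -> v \in V ->
    enorm (x - y - v) < 1 / (2 * (1 + L)) * enorm (x - y) ->
    1 / (2 * (2 + L)) * enorm (x - y) <= enorm (y - z).
Proof.
move=> L0 [W [F [dW FW FL ->]]]; have [V [dV VP WV]] := orthocompl_vspace W.
exists V; first by rewrite /Gr /= dV dW.
move=> _ y _ v [a /= aW <-] [e /= eW <-] vV.
set x := a + F a; set z := e + F e => xyv.
have FV u : u \in W -> F u \in V by move=> uW; apply/VP; exact: FW.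
(* [q'] is the component in [W] of [x - y - v], and [a - e - q'] that of [y - z] *)
have [q qV qW] := WV (x - y - v).
set q' := x - y - v - q in qW.
have q'le : enorm q' <= enorm (x - y - v).
  have -> : x - y - v = q' + q by rewrite /q' subrK.
  by apply: orthogonal_enorm_le; rewrite edotC; move/VP: qV; exact.
have aele : enorm (a - e - q') <= enorm (y - z).
  have -> : y - z = (a - e - q') + (F a - F e - v - q).
    by apply/rowP => i; rewrite /q' /x /z !mxE; ring.
  apply: orthogonal_enorm_le; rewrite edotC.
  have : F a - F e - v - q \in V by rewrite !rpredB // FV.
  move=> /VP; apply; apply: rpredB => //; exact: rpredB.
have ae : enorm (a - e) <= enorm (y - z) + enorm (x - y - v).
  have -> : a - e = (a - e - q') + q' by rewrite subrK.
  by apply: le_trans (enormD _ _) _; lra.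
have xz : enorm (x - z) <= (1 + L) * enorm (a - e).
  have -> : x - z = (a - e) + (F a - F e) by apply/rowP => i; rewrite /x /z !mxE; ring.
  by apply: le_trans (enormD _ _) _; rewrite mulrDl mul1r lerD2l FL.
have xy : enorm (x - y) <= enorm (x - z) + enorm (y - z).
  by rewrite (enormB y z) enorm_triangle.
rewrite mul1r ler_pdivrMl; last by lra.
have L1 : 0 < 2 * (1 + L) by lra.
move: xyv; rewrite mul1r ltr_pdivlMl // => xyv.
have := ler_wpM2l (_ : 0 <= 1 + L) ae; nra.
Qed.

End GraphCones.

Section GraphPacking.
Context {R : realType} {d : nat}.
Variables (n : nat) (E : set 'rV[R]_d) (C0 C1 : R).
Hypotheses (C00 : 0 < C0) (C10 : 0 < C1).
Hypothesis adrE : forall x (r : R), E x -> 0 < r -> (r%:E < diam E)%E ->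
  ((C0 * r ^+ n)%:E <= hausdorff n (E `&` eball x r) <= (C1 * r ^+ n)%:E)%E.

Definition off_graph (Gamma : set 'rV[R]_d) x1 (r c b : R) : set 'rV[R]_d :=
  [set y | [/\ E y, eball x1 (2 * r) y, nbhd Gamma b y & ~ nbhd Gamma (c * b) y]].

Definition off_graph_scale Gamma x1 (r c b : R) : set 'rV[R]_d :=
  [set x | exists2 y, off_graph Gamma x1 r c b y & enorm (x - y) < b].

Lemma off_graph_scale_eopen Gamma x1 (r c b : R) : eopen (off_graph_scale Gamma x1 r c b).
Proof.
move=> x [y Ay xy]; exists (b - enorm (x - y)); first by rewrite subr_gt0.
move=> w; rewrite eballE => xw; exists y => //.
have := enorm_triangle x w y; rewrite (enormB w x); lra.
Qed.

(** The measure near the points at distance about [b k = r / 2 ^ k] from [Gamma]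
    is controlled by that of a slightly larger layer [T k] around [Gamma], which
    contains the balls of radius [c * b k / 2] about these points; a point lies in
    boundedly many layers. *)
Lemma sum_off_graph_scale_le (c : R) : 0 < c -> c <= 1 ->
  exists2 K : R, 0 < K & forall Gamma x1 (r : R) J,
    E x1 -> 0 < r -> ((3 * r)%:E < diam E)%E ->
    (\sum_(k < J) hausdorff n (E `&` off_graph_scale Gamma x1 r c (r / 2 ^+ k))
       <= (K * r ^+ n)%:E)%E.
Proof.
move=> c0 c1.
have [m m4] : exists m, 4 / 2 ^+ m <= c.
  have c8 : 0 < c / 8 by rewrite divr_gt0.
  have c81 : c / 8 < 1 by lra.
  have [k /andP[+ _]] := dyadic_scale c8 c81.
  by rewrite exprS invfM mul1r => h; exists k; lra.
pose D := C1 / C0 * (4 / c) ^+ n.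
have D0 : 0 < D by apply: mulr_gt0; [exact: divr_gt0|apply: exprn_gt0; exact: divr_gt0].
exists (D * (C1 * 3 ^+ n * m.+1%:R)).
  by apply: mulr_gt0 => //; apply: mulr_gt0; [apply: mulr_gt0 => //; exact: exprn_gt0|rewrite ltr0n].
move=> Gamma x1 r J Ex1 r0 rE.
pose b k : R := r / 2 ^+ k.
have b0 k : 0 < b k by rewrite divr_gt0 // exprn_gt0.
have br k : b k <= r.
  by rewrite ler_pdivrMr ?exprn_gt0 // ler_peMr ?exprn_ege1 ?ler1n // ltW.
pose T k := nbhd Gamma (2 * b k) `&` ~` nbhd Gamma (c * b k / 2).
have mT k : (hausdorff n : set 'rV[R]_d -> \bar R).-caratheodory (T k).
  apply: caratheodory_measurable_setI; first by apply: hausdorff_eopen; exact: nbhd_eopen.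
  by apply: caratheodory_measurable_setC; apply: hausdorff_eopen; exact: nbhd_eopen.
pose B := E `&` eball x1 (3 * r).
have BC : (hausdorff n B <= (C1 * (3 * r) ^+ n)%:E)%E.
  by apply: (ADR_upper adrE) => //; rewrite mulr_gt0.
have one k : (hausdorff n (E `&` off_graph_scale Gamma x1 r c (b k)) <=
    D%:E * hausdorff n (B `&` T k))%E.
  have -> : D = C1 * (2 * b k) ^+ n / (C0 * (c * b k / 2) ^+ n).
    have -> : (2 * b k) ^+ n = (4 / c) ^+ n * (c * b k / 2) ^+ n.
      by rewrite -exprMn; congr (_ ^+ n); field; rewrite gt_eqF.
    have cb : (c * b k / 2) ^+ n != 0 by rewrite expf_neq0 // gt_eqF // divr_gt0 // mulr_gt0.
    by rewrite /D; field; rewrite cb gt_eqF.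
  rewrite /B -setIA; apply: hausdorff_neighbourhood_le => //.
  - by rewrite divr_gt0 // mulr_gt0.
  - by have := b0 k; nra.
  - by apply: le_lt_trans rE; rewrite lee_fin; have := br k; lra.
  - by move=> y [].
  - move=> y [Ey y1 [z Gz yz] yc] w; rewrite eballE => yw.
    have bk := b0 k; have cb : c * b k <= b k by rewrite ler_piMl // ltW.
    split; first by move: y1; rewrite !eballE => y1; apply: le_lt_trans (enorm_triangle y _ _) _;
      have := br k; lra.
    split.
      exists z => //; apply: le_lt_trans (enorm_triangle y _ _) _.
      by rewrite (enormB w y); lra.
    move=> [u Gu wu]; apply: yc; exists u => //.
    by apply: le_lt_trans (enorm_triangle w _ _) _; lra.
  - apply: (@le_lt_trans _ _ (C1 * (3 * r) ^+ n)%:E); last exact: ltry.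
    by apply: le_trans BC; apply: le_hausdorff => x [? []].
apply: (@le_trans _ _ (\sum_(k < J) D%:E * hausdorff n (B `&` T k))%E).
  by apply: lee_sum => k _; exact: one.
rewrite -ge0_sume_distrr; last by move=> k _; exact: hausdorff_ge0.
rewrite -(mulrA D) [leRHS]EFinM; apply: lee_wpmul2l; first by rewrite lee_fin ltW.
apply: le_trans (sum_outer_measure_le (m := m.+1) mT _) _.
  move=> x _; apply: count_below_spread => i j ij [_ ni] [[z Gz xz] _].
  apply: ni; exists z => //; apply: lt_le_trans xz _.
  have bj : b j <= b i / 2 ^+ m.
    rewrite /b -mulrA -invfM -exprD ler_pM2l // lef_pV2 ?posrE ?exprn_gt0 //.
    by rewrite ler_weXn2l ?ler1n //; lia.
  have := ler_wpM2l (ltW (b0 i)) m4; lra.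
apply: le_trans (le_enatmul (hausdorff_ge0 _ _) BC (leqnn _)) _.
rewrite -EFin_natmul lee_fin -[leLHS]mulr_natr exprMn le_eqVlt.
by apply/orP; left; apply/eqP; ring.
Qed.

End GraphPacking.

Section BPLGtoBPBE.
Context {R : realType} {d : nat}.
Variables (n : nat) (p : R) (E : set 'rV[R]_d) (C0 C1 : R).
Hypotheses (n0 : (0 < n)%N) (nd : (n < d)%N) (p1 : 1 <= p).
Hypotheses (C00 : 0 < C0) (C10 : 0 < C1).
Hypothesis adrE : forall x (r : R), E x -> 0 < r -> (r%:E < diam E)%E ->
  ((C0 * r ^+ n)%:E <= hausdorff n (E `&` eball x r) <= (C1 * r ^+ n)%:E)%E.

Let mu := outer_restr (hausdorff n) E.

Lemma supp_approx x (e : R) : supp mu x -> 0 < e -> exists2 y, E y & enorm (x - y) < e.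
Proof.
move=> sx e0; have := sx _ e0; rewrite /mu /= /outer_restr => h.
have [A0|/set0P[y [xy Ey]]] := eqVneq (eball x e `&` E) set0; last by exists y.
by move: h; rewrite A0 hausdorff0 ltxx.
Qed.

(** For each [t], the coarsest scale of the points of [E] in the cone truncated at
    [t] gives the bound on the measure of that cone. *)
Lemma conical_energy_le (V : {vspace 'rV[R]_d}) x (alpha r : R) (s : seq nat) :
  E x -> 0 < r -> (r%:E < diam E)%E ->
  (forall k y, E y -> cone x V alpha r y ->
     r / 2 ^+ k.+1 <= enorm (x - y) < r / 2 ^+ k -> k \in s) ->
  (conical_energy n p mu x V alpha r <= ((C1 * 2 ^+ n) `^ p * (size s)%:R)%:E)%E.
Proof.
move=> Ex r0 rE sP.
have mu_ge0 t : (0 <= mu (cone x V alpha t))%E by exact: outer_restr_ge0.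
apply: energy_integral_le => //.
move=> t /andP[t0 tr].
have cone_mono y : cone x V alpha t y -> cone x V alpha r y.
  by move=> [xy ?]; split => //; move: xy; rewrite !eballE => /lt_trans; apply.
pose P k := `[< exists y, [/\ E y, cone x V alpha t y &
  r / 2 ^+ k.+1 <= enorm (x - y) < r / 2 ^+ k] >].
have scale y : E y -> cone x V alpha t y -> exists2 k, P k & enorm (x - y) < r / 2 ^+ k.
  move=> Ey Cy; have [xyt [v vV xyv]] := cone_witness Cy.
  have xy0 : 0 < enorm (x - y).
    rewrite lt_neqAle enorm_ge0 andbT eq_sym; apply/negP => /eqP xy0.
    by move: xyv; rewrite xy0 mulr0 ltNge enorm_ge0.
  have [k k12] := dyadic_scale xy0 (lt_trans xyt tr).
  by exists k; [apply/asboolP; exists y|case/andP: k12].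
have [exP|noP] := pselect (exists k, P k); last first.
  left; rewrite /mu /= /outer_restr (_ : _ `&` _ = set0) ?hausdorff0 //.
  apply/seteqP; split => // y [Cy Ey]; have [k Pk _] := scale y Ey Cy.
  by apply: noP; exists k.
right; have [k /asboolP[y [Ey Cy k12]] kmin] := ex_minnP exP.
have rk0 : 0 < r / 2 ^+ k by rewrite divr_gt0 // exprn_gt0.
exists k; first exact: (sP k y Ey (cone_mono _ Cy) k12).
split.
  by have [xyt _] := cone_witness Cy; case/andP: k12 => h _; exact: le_trans h (ltW xyt).
apply: le_trans (ADR_upper adrE Ex rk0 _); last first.
  apply: le_lt_trans rE; rewrite lee_fin ler_pdivrMr ?exprn_gt0 //.
  by rewrite ler_peMr ?exprn_ege1 ?ler1n // ltW.
rewrite /mu /= /outer_restr setIC; apply: le_hausdorff => z [Ez Cz]; split => //.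
have [j /kmin kj] := scale z Ez Cz; rewrite eballE => /lt_le_trans; apply.
by rewrite ler_pM2l // lef_pV2 ?posrE ?exprn_gt0 // ler_weXn2l ?ler1n.
Qed.

Lemma BPLG_BPBE : BPLG n E -> BPBE n p mu.
Proof.
move=> [kappa [L [kappa0 [L0 big]]]].
pose c0 : R := 1 / (2 * (2 + L)); pose alpha : R := 1 / (2 * (1 + L)).
have c00 : 0 < c0 by rewrite divr_gt0 //; lra.
have alpha0 : 0 < alpha by rewrite divr_gt0 //; lra.
have c01 : c0 / 2 <= 1.
  suff : c0 <= 1 by lra.
  by rewrite /c0 ler_pdivrMr; lra.
have c02 : 0 < c0 / 2 by rewrite divr_gt0.
have [K K0 KP] := sum_off_graph_scale_le C00 C10 adrE c02 c01.
pose m := Num.bound (4 * K / kappa).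
have mK : 4 * K <= kappa * m.+1%:R.
  rewrite [leRHS]mulrC -ler_pdivrMr //; apply: ltW.
  apply: lt_trans (archi_boundP _) _; first by rewrite divr_ge0 ?mulr_ge0 // ltW.
  by rewrite ltr_nat.
pose M0 := (C1 * 2 ^+ n) `^ p * (m + 4)%:R.
exists alpha, (kappa / (2 * C1 * 32 ^+ n)), M0.
split => //; split.
  by apply: divr_gt0 => //; apply: mulr_gt0; [exact: mulr_gt0|exact: exprn_gt0].
split.
  apply: mulr_gt0; last by rewrite ltr0n addn_gt0 orbT.
  by apply: powR_gt0; apply: mulr_gt0 => //; exact: exprn_gt0.
move=> x0 r0 sx0 r00 rsupp.
(* [x0] is only a limit of points of [E]: replace it by a nearby [x1] in [E], with a
   slightly larger radius, still less than [diam E] *)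
have [x1 [e [Ex1 e0 x01 e1 reE]]] : exists x1 (e : R),
    [/\ E x1, 0 < e, enorm (x0 - x1) < e, e <= r0 / 16 & ((r0 + e)%:E < diam E)%E].
  have [a [b [sa sb rab]]] := lt_diam (ltW r00) rsupp.
  pose e := Num.min ((enorm (a - b) - r0) / 4) (r0 / 16).
  have e0 : 0 < e by rewrite lt_min !divr_gt0 // subr_gt0.
  have : e <= e by []; rewrite {2}/e le_min => /andP[e1 e2].
  have [x1 Ex1 x01] := supp_approx sx0 e0.
  have [a' Ea' aa'] := supp_approx sa e0; have [b' Eb' bb'] := supp_approx sb e0.
  exists x1, e; split => //; apply: (diam_gt Ea' Eb').
  have := enorm_triangle a' a b; have := enorm_triangle b' a' b.
  rewrite (enormB b' b); lra.
have r0E : (r0%:E < diam E)%E by apply: lt_trans reE; rewrite lte_fin; lra.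
(* the piece of graph is taken in a ball of radius [r], so that all balls met in the
   packing argument have radii less than [r0] *)
pose r := r0 / 16; have r_gt0 : 0 < r by rewrite divr_gt0.
have sub_ball x (u : R) : enorm (x0 - x1) + u <= r0 -> enorm (x1 - x) < u -> eball x0 r0 x.
  by move=> h xu; rewrite eballE; apply: le_lt_trans (enorm_triangle x1 _ _) _; lra.
have muball : (mu (eball x0 r0) <= (C1 * (2 * r0) ^+ n)%:E)%E.
  apply: (@le_trans _ _ (C1 * (r0 + e) ^+ n)%:E).
    apply: le_trans (ADR_upper adrE Ex1 _ reE); last lra.
    rewrite /mu /= /outer_restr setIC; apply: le_hausdorff => x [Ex xx0]; split => //.
    rewrite eballE; apply: le_lt_trans (enorm_triangle x0 _ _) _.
    by move: xx0; rewrite eballE (enormB x1 x0); lra.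
  by rewrite lee_fin ler_pM2l // ler_pXn2r ?nnegrE //; lra.
have rE : (r%:E < diam E)%E by apply: lt_trans r0E; rewrite lte_fin /r; lra.
have [Gamma [Gammalip Gammabig]] := big x1 r Ex1 r_gt0 rE.
have [V dV VP] := graph_cone_dist L0 Gammalip.
pose X := E `&` eball x1 r `&` Gamma.
pose O k := off_graph_scale E Gamma x1 r (c0 / 2) (r / 2 ^+ k).
have mO k : (hausdorff n : set 'rV[R]_d -> \bar R).-caratheodory (O k).
  by apply: hausdorff_eopen; exact: off_graph_scale_eopen.
have sumO J : (\sum_(k < J) hausdorff n (X `&` O k) <= (K * r ^+ n)%:E)%E.
  apply: le_trans (KP Gamma x1 r J Ex1 r_gt0 _); last first.
    by apply: lt_trans r0E; rewrite lte_fin /r; lra.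
  by apply: lee_sum => k _; apply: le_hausdorff => x [[[]]].
have kr0 : 0 < kappa * r ^+ n by rewrite mulr_gt0 // exprn_gt0.
have mKr : 4 * (K * r ^+ n) <= kappa * r ^+ n * m.+1%:R.
  by rewrite mulrA (mulrAC kappa) ler_pM2r // exprn_gt0.
have := bounded_count_big_piece kr0 mO sumO mKr.
set G := X `&` _ => XG.
have GX : G `<=` X by move=> x [].
have Gbig : ((kappa * r ^+ n / 2)%:E <= hausdorff n G)%E.
  have := le_trans Gammabig XG; rewrite -leeBlDr // -EFinB.
  by apply: le_trans; rewrite lee_fin; lra.
exists G, V; split => //.
- move=> x /GX[[Ex]]; rewrite eballE => xx1 _; apply: sub_ball xx1; rewrite /r; lra.
- apply: (@le_trans _ _ (hausdorff n G)); last first.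
    by apply: le_hausdorff => x xG; split => //; have [[]] := GX _ xG.
  apply: le_trans Gbig.
  apply: le_trans (lee_wpmul2l _ muball) _.
    by rewrite lee_fin divr_ge0 ?(ltW kappa0) // !mulr_ge0 ?exprn_ge0 // ltW.
  rewrite -EFinM lee_fin le_eqVlt; apply/orP; left; apply/eqP.
  have -> : 2 * r0 = 32 * r by rewrite /r; field.
  by rewrite exprMn; field; rewrite (gt_eqF C10) expf_neq0.
move=> z [[[Ez z1] Gz] zcount].
have [s0 s0m s0P] := bounded_count_seq zcount.
(* [O k] describes the scale [r / 2 ^ k = r0 / 2 ^ (4 + k)]; the four coarser scales
   are added by hand *)
pose s := [:: 0; 1; 2; 3]%N ++ [seq (4 + k)%N | k <- s0].
apply: le_trans (conical_energy_le (s := s) Ez r00 r0E _) _; last first.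
  rewrite lee_fin ler_wpM2l ?powR_ge0 // ler_nat /s size_cat size_map addnC /=.
  by rewrite leq_add2r.
move=> k y Ey Cy /andP[k1 k2]; have [k4|k4] := ltnP k 4.
  by rewrite mem_cat; apply/orP; left; move: k k4 {k1 k2} => [|[|[|[|]]]].
rewrite mem_cat; apply/orP; right; apply/mapP; exists (k - 4)%N; last by rewrite subnKC.
have bE : r / 2 ^+ (k - 4) = r0 / 2 ^+ k.
  rewrite /r -mulrA -invfM (_ : 16 = 2 ^+ 4 :> R) -?exprD ?subnKC //.
  by rewrite -natrX.
have b2 : r0 / 2 ^+ k.+1 = r0 / 2 ^+ k / 2 by rewrite exprSr invfM mulrA.
have br : r0 / 2 ^+ k <= r.
  by rewrite -bE ler_pdivrMr ?exprn_gt0 // ler_peMr ?exprn_ege1 ?ler1n // ltW.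
apply: s0P; exists y; last by rewrite bE.
rewrite bE; split => //.
- rewrite eballE; apply: le_lt_trans (enorm_triangle z _ _) _.
  by move: z1; rewrite eballE; lra.
- by exists z => //; rewrite enormB.
- move=> [w Gw yw]; have [_ [v vV zyv]] := cone_witness Cy.
  have := VP _ y _ _ Gz Gw vV zyv; rewrite -/c0 => h.
  have := ler_wpM2l (ltW c00) k1; rewrite b2; lra.
Qed.

End BPLGtoBPBE.

Theorem theorem1p11 (R : realType) (n d : nat) (p : R) (E : set 'rV[R]_d) :
  (0 < n)%N -> (n < d)%N -> 1 <= p ->
  ADR n E ->
  BPLG n E <-> BPBE n p (outer_restr (hausdorff n) E).
Proof.
move=> n0 nd p1 [C0 [C1 [C00 [C10 adrE]]]]; split.
  exact: (BPLG_BPBE n0 p1 C00 C10 adrE).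
exact: (BPBE_BPLG n0 nd p1 C00 adrE).
Qed.
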